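(* Let $S$ be a CSP with parameters $w,\ell,W,q,s$ and type $\mathcal R$, and let $m$ be the number of constraints of the instances. (a) If $\bigcup S$ is solvable in time $T$, then $\mathrm{H}(S)_{\{\mathcal V\}}$ is solvable in time $O\big((T+s\cdot \mathrm{comp}(\mathcal R))\cdot m\cdot \min\{\dim(\bigcup\mathcal R),|W_q|\}\big)$. (b) If $\mathrm{H}(S)_{\{\mathcal V\}}$ is solvable in time $T$, then $\bigcup S$ is solvable in time $O\big(T\cdot m\cdot \mathrm{comp}(\bigcup\mathcal R)\big)$.
   Context: Notation: $[k]=\{1,\dots,k\}$, $\langle k\rangle=\{0,1,\dots,k-1\}$. A constraint satisfaction problem (CSP) $S$ is specified, for every positive integer $n$, by parameters: alphabet size $w=w(n)$, assignment length $\ell=\ell(n)$, a set of admissible assignments $W\subseteq\langle w\rangle^{\ell}$ that is symmetric (closed under permuting coordinates), arity $q=q(n)$, number of relations $s=s(n)$; and by its type, a set $\mathcal R=\{R_1,\dots,R_s\}$ of $q$-ary relations $R_k\subseteq W_q$, where $W_q=\{u\in\langle w\rangle^q: uv\in W\text{ for some }v\in\langle w\rangle^{\ell-q}\}$. Let $[\ell]^{(q)}$ denote the set of $q$-tuples of pairwise distinct elements of $[\ell]$. An instance is a set $\mathcal C=\{C_1,\dots,C_m\}$ of constraints over variables $\mathcal V=\{x_1,\dots,x_\ell\}$, each of the form $R_k(x_{j_1},\dots,x_{j_q})$ with $k\in[s]$, $(j_1,\dots,j_q)\in[\ell]^{(q)}$; $a\in W$ satisfies it if $(a_{j_1},\dots,a_{j_q})\in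 R_k$, and satisfies $\mathcal C$ if it satisfies all its constraints. Solving $S$ means: on an instance, output a satisfying assignment in $W$ if one exists, and ''no'' otherwise. Hidden CSP: for $\mathcal U\subseteq\{\mathcal R,\mathcal V\}$, the problem $\mathrm{H}(S)_{\mathcal U}$ has the parameters and type of $S$, but the algorithm is given only $n$ and $m$; the instance $\mathcal C$ is accessible only through a $\mathcal U$-revealing oracle: on a query $a\in W$ it answers ''yes'' if $a$ satisfies $\mathcal C$; otherwise it returns the index $j$ of some (arbitrarily chosen) constraint $C_j=R_k(x_{j_1},\dots,x_{j_q})$ violated by $a$, together with $k$ if $\mathcal R\in\mathcal U$, and together with $(j_1,\dots,j_q)$ if $\mathcal V\in\mathcal U$. An algorithm solves $\mathrm{H}(S)_{\mathcal U}$ if for all $n,m$, every instance and every $\mathcal U$-revealing oracle for it, it outputs a satisfying assignment if one exists and ''no'' otherwise; its complexity is the worst-case number of steps, each oracle query counting as one step. For a relation $R$, $\mathrm{comp}(R)$ is the time complexity of deciding membership of a tuple in $R$; for a set of relations, $\mathrm{comp}(\mathcal R)=\max_{R\in\mathcal R}\mathrm{comp}(R)$. $\dim(\mathcal R)$ is the length of the longest chain (under inclusion) of relations in $\mathcal R$. $\bigcup\mathcal R=\{\bigcup_{R\in\mathcal R'}R:\mathcal R'\subseteq\mathcal R\}$, and $\bigcup S$ is the CSP with the same parameters as $S$ and type $\bigcup\mathcal R$. *)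

(* Defs.v *)
From mathcomp Require Import all_boot perm.

Set Implicit Arguments.
Unset Strict Implicit.
Unset Printing Implicit Defensive.

(** * Model of computation

    A uniform-cost random access machine, programmed with structured control
    flow.  A program uses finitely many scalar variables and finitely many
    unbounded arrays of natural numbers, all initially 0.  Arithmetic is
    addition and truncated subtraction of scalars.  The input is a read-only,
    random-access device; [Query] is the oracle call. *)

Inductive cmd : Type :=
| Skip
| Const (x c : nat)
| Add (x y z : nat)
| Sub (x y z : nat)
| Get (x a y : nat)      (* x := a[y] *)
| Put (a x y : nat)      (* a[x] := y *)
| Read (x f y z : nat)   (* x := cell (y, z) of the read-only field number f *)
| Query                  (* submit the contents of array 0 to the oracle *)
| Seq (c1 c2 : cmd)
| If (x : nat) (c1 c2 : cmd)   (* x <> 0 means true *)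
| While (x : nat) (c : cmd).

Record store := Store { var : nat -> nat; arr : nat -> nat -> nat }.

Definition upd (f : nat -> nat) (i v : nat) : nat -> nat :=
  fun j => if j == i then v else f j.

Definition set_var (st : store) (x v : nat) : store :=
  Store (upd (var st) x v) (arr st).

Definition set_arr (st : store) (a i v : nat) : store :=
  Store (var st) (fun b => if b == a then upd (arr st a) i v else arr st b).

Definition store0 : store := Store (fun=> 0) (fun _ _ => 0).

(** The outside world of a program, with state space [E].  A query on which
    [io_query] returns [None] is illegal, and the program gets stuck on it. *)
Record device (E : Type) := Device {
  io_read : E -> nat -> nat -> nat -> nat;
  io_query : E -> (nat -> nat) -> option E }.

(** [exec io c e st e' st' t]: started in device state [e] and store [st], the
    program [c] halts in [e'] and [st'] after exactly [t] steps. *)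
Inductive exec (E : Type) (io : device E) :
  cmd -> E -> store -> E -> store -> nat -> Prop :=
| ESkip e st : exec io Skip e st e st 1
| EConst x c e st : exec io (Const x c) e st e (set_var st x c) 1
| EAdd x y z e st :
    exec io (Add x y z) e st e (set_var st x (var st y + var st z)) 1
| ESub x y z e st :
    exec io (Sub x y z) e st e (set_var st x (var st y - var st z)) 1
| EGet x a y e st :
    exec io (Get x a y) e st e (set_var st x (arr st a (var st y))) 1
| EPut a x y e st :
    exec io (Put a x y) e st e (set_arr st a (var st x) (var st y)) 1
| ERead x f y z e st :
    exec io (Read x f y z) e st e
      (set_var st x (io_read io e f (var st y) (var st z))) 1
| EQuery e e' st :
    io_query io e (arr st 0) = Some e' -> exec io Query e st e' st 1
| ESeq c1 c2 e e1 e2 st st1 st2 t1 t2 :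
    exec io c1 e st e1 st1 t1 -> exec io c2 e1 st1 e2 st2 t2 ->
    exec io (Seq c1 c2) e st e2 st2 (t1 + t2)
| EIfTrue x c1 c2 e e' st st' t :
    var st x != 0 -> exec io c1 e st e' st' t ->
    exec io (If x c1 c2) e st e' st' t.+1
| EIfFalse x c1 c2 e e' st st' t :
    var st x == 0 -> exec io c2 e st e' st' t ->
    exec io (If x c1 c2) e st e' st' t.+1
| EWhileTrue x c e e1 e2 st st1 st2 t1 t2 :
    var st x != 0 -> exec io c e st e1 st1 t1 ->
    exec io (While x c) e1 st1 e2 st2 t2 ->
    exec io (While x c) e st e2 st2 (t1 + t2).+1
| EWhileFalse x c e st :
    var st x == 0 -> exec io (While x c) e st e st 1.

(** * Constraint satisfaction problems

    Indices are 0-based: [k] = {1, ..., k} and <k> = {0, ..., k-1} are both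
    represented by ['I_k]. *)

(** W_q, the set of initial segments of length q of elements of W. *)
Definition prefixes (l w q : nat) (W : {set l.-tuple 'I_w}) :
    {set q.-tuple 'I_w} :=
  [set u : q.-tuple 'I_w |
    [exists v : (l - q).-tuple 'I_w,
      [exists a in W, tval a == tval u ++ tval v]]].

(** The conditions on the parameters are required for positive n only.
    Degenerate parameters (no admissible assignment, q > l) are excluded. *)
Record params := Params {
  alph : nat -> nat;    (* w *)
  len : nat -> nat;     (* l *)
  arity : nat -> nat;   (* q *)
  nrel : nat -> nat;    (* s *)
  adm : forall n, {set (len n).-tuple 'I_(alph n)};   (* W *)
  adm_sym : forall n, 0 < n ->
    forall (p : 'S_(len n)) (a : (len n).-tuple 'I_(alph n)),
    a \in adm n -> [tuple tnth a (p i) | i < len n] \in adm n;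
  adm_neq0 : forall n, 0 < n -> adm n != set0;
  arity_le : forall n, 0 < n -> arity n <= len n;
  nrel_gt0 : forall n, 0 < n -> 0 < nrel n }.

Definition assignment (P : params) (n : nat) := (len P n).-tuple 'I_(alph P n).
Definition qtuple (P : params) (n : nat) := (arity P n).-tuple 'I_(alph P n).

Definition Wq (P : params) (n : nat) : {set qtuple P n} :=
  prefixes (arity P n) (adm P n).

(** The type {R_1, ..., R_s} is a set of s relations, so the enumeration is
    injective. *)
Record csp := CSP {
  par :> params;
  rel_of : forall n, 'I_(nrel par n) -> {set qtuple par n};
  rel_inj : forall n, 0 < n -> injective (@rel_of n);
  rel_sub : forall n, 0 < n -> forall k, rel_of k \subset Wq par n }.

(** A type together with the way its relations are presented to algorithms:
    relations are referred to by names, and the name [r] is given to a program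
    as the random-access array [rcode r]. *)
Record family (P : params) := Family {
  rname : nat -> finType;
  rden : forall n, rname n -> {set qtuple P n};
  rcode : forall n, rname n -> nat -> nat }.

(** The type of S: R_k is named by its index k. *)
Definition base_type (S : csp) : family S :=
  @Family S (fun n => 'I_(nrel S n)) (@rel_of S) (fun n k _ => k).

(** The type of the union CSP: a relation is named by the subset K of [s]
    whose relations are united, given by its characteristic vector. *)
Definition union_type (S : csp) : family S :=
  @Family S (fun n => {set 'I_(nrel S n)})
    (fun n K => \bigcup_(k in K) rel_of k)
    (fun n K i => if insub i is Some k then (k \in K : nat) else 0).

Definition union_rels (S : csp) (n : nat) : {set {set qtuple S n}} :=
  [set \bigcup_(k in K) rel_of k | K : {set 'I_(nrel S n)}].

(** The largest number of members of a chain in X. *)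
Definition dim (U : finType) (X : {set {set U}}) : nat :=
  \max_(C : {set {set U}} | (C \subset X) &&
        [forall A in C, forall B in C, (A \subset B) || (B \subset A)]) #|C|.

Record constr (P : params) (F : family P) (n : nat) := Constr {
  crel : rname F n;
  cscope : (arity P n).-tuple 'I_(len P n);
  cscope_uniq : uniq cscope }.

(** C_1, ..., C_m are indexed, since oracles refer to constraints by index. *)
Definition instance (P : params) (F : family P) (n m : nat) :=
  m.-tuple (constr F n).

Definition restrict (P : params) (n : nat)
    (J : (arity P n).-tuple 'I_(len P n)) (a : assignment P n) : qtuple P n :=
  [tuple tnth a (tnth J i) | i < arity P n].

Definition sat_constr (P : params) (F : family P) (n : nat) (c : constr F n)
    (a : assignment P n) : bool :=
  restrict (cscope c) a \in rden (crel c).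

Definition sat (P : params) (F : family P) (n m : nat) (C : instance F n m)
    (a : assignment P n) : bool :=
  [forall j : 'I_m, sat_constr (tnth C j) a].

(** * Algorithms and their running times

    Field 0 of the input device always contains n, m and the parameters
    w(n), l(n), q(n), s(n), which algorithms are thus given. *)
Definition param_input (P : params) (n m i : nat) : nat :=
  nth 0 [:: n; m; alph P n; len P n; arity P n; nrel P n] i.

Definition no_query (E : Type) : E -> (nat -> nat) -> option E :=
  fun _ _ => None.

Definition spells (d l : nat) (f : nat -> nat) (a : l.-tuple 'I_d) : bool :=
  mkseq f l == map val a.

(** Membership of u in the relation named r (m is not available, so 0).
    Field 1 contains the name, field 2 the tuple. *)
Definition member_device (P : params) (F : family P) (n : nat)
    (r : rname F n) (u : qtuple P n) : device unit :=
  Device (fun _ f y _ =>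
      match f with
      | 0 => param_input P n 0 y
      | 1 => rcode r y
      | 2 => nth 0 (map val u) y
      | _ => 0
      end) (@no_query unit).

(** The time complexity of the membership problem is at most [t]: t(n) steps
    suffice for every relation of the type and every tuple of W_q.  The answer
    is the final value of variable 0. *)
Definition member_in_time (P : params) (F : family P) (t : nat -> nat) : Prop :=
  exists D : cmd, forall n, 0 < n ->
  forall (r : rname F n) (u : qtuple P n), u \in Wq P n ->
  exists st k,
    [/\ exec (member_device r u) D tt store0 tt st k,
        k <= t n &
        (var st 0 != 0) = (u \in rden r)].

(** A final store answers "no" if variable 0 is 0; otherwise the answer is the
    assignment in array 0. *)
Definition correct_answer (P : params) (F : family P) (n m : nat)
    (C : instance F n m) (st : store) : Prop :=
  if var st 0 == 0 then forall a, a \in adm P n -> ~~ sat C a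
  else exists a, [/\ a \in adm P n, sat C a & spells (arr st 0) a].

(** Writing out an assignment counts one step per variable. *)
Definition output_steps (P : params) (n : nat) (st : store) : nat :=
  if var st 0 == 0 then 0 else len P n.

(** Field 1 contains the names of the relations of the constraints, field 2
    their tuples of variables. *)
Definition csp_device (P : params) (F : family P) (n m : nat)
    (C : instance F n m) : device unit :=
  Device (fun _ f y z =>
      match f with
      | 0 => param_input P n m y
      | 1 => nth (fun=> 0) [seq rcode (crel c) | c <- C] y z
      | 2 => nth 0 (nth [::] [seq map val (cscope c) | c <- C] y) z
      | _ => 0
      end) (@no_query unit).

Definition csp_in_time (P : params) (F : family P) (T : nat -> nat -> nat) :
    Prop :=
  exists A : cmd, forall n m, 0 < n -> 0 < m -> forall C : instance F n m,
  exists st k,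
    [/\ exec (csp_device C) A tt store0 tt st k,
        k + output_steps P n st <= T n m &
        correct_answer C st].

(** Replies of a {V}-revealing oracle: [None] is "yes", [Some j] is the index of
    a violated constraint, whose tuple of variables is revealed as well.  The
    choice of j may depend on the previous queries and replies. *)
Definition history (P : params) (n m : nat) :=
  seq (assignment P n * option 'I_m).

Definition oracle (P : params) (n m : nat) :=
  history P n m -> assignment P n -> option 'I_m.

Definition valid_oracle (P : params) (F : family P) (n m : nat)
    (C : instance F n m) (O : oracle P n m) : Prop :=
  forall h a, a \in adm P n ->
  if O h a is Some j then ~~ sat_constr (tnth C j) a else sat C a.

Definition last_reply (P : params) (n m : nat) (h : history P n m) :
    option (option 'I_m) := omap snd (ohead h).

(** The device state is the history, latest query first.  Field 1 contains the
    latest reply: cell 0 is 1 for "yes" and 0 otherwise, cell 1 is j.  Field 2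
    contains the revealed variables of the latest reply.  The relations are not
    readable. *)
Definition hidden_device (P : params) (F : family P) (n m : nat)
    (C : instance F n m) (O : oracle P n m) : device (history P n m) :=
  Device (fun h f y _ =>
      match f with
      | 0 => param_input P n m y
      | 1 => match last_reply h with
             | None => 0
             | Some None => nth 0 [:: 1] y
             | Some (Some j) => nth 0 [:: 0; val j] y
             end
      | 2 => if last_reply h is Some (Some j)
             then nth 0 (map val (cscope (tnth C j))) y else 0
      | _ => 0
      end)
    (fun h f =>
      if [pick a in adm P n | spells f a] is Some a
      then Some ((a, O h a) :: h) else None).

Definition hidden_in_time (P : params) (F : family P) (T : nat -> nat -> nat) :
    Prop :=
  exists B : cmd, forall n m, 0 < n -> 0 < m ->
  forall (C : instance F n m) (O : oracle P n m), valid_oracle C O ->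
  exists h st k,
    [/\ exec (hidden_device C O) B [::] store0 h st k,
        k + output_steps P n st <= T n m &
        correct_answer C st].

Definition csp_in_O (P : params) (F : family P) (f : nat -> nat -> nat) : Prop :=
  exists c, csp_in_time F (fun n m => c * f n m).

Definition hidden_in_O (P : params) (F : family P) (f : nat -> nat -> nat) :
    Prop :=
  exists c, hidden_in_time F (fun n m => c * f n m).

(* Main.v *)
(* (a) Keep, for every constraint whose scope has been revealed, the set of
   relations it may still have; a constraint not yet revealed is replaced by a
   copy of a revealed one.  Every solution of the hidden instance satisfies this
   instance of the union CSP, so its solution is a safe query.  A violated
   constraint j, with revealed scope J, loses the relations containing a|J; if J
   was known already, the union of the remaining ones shrinks strictly.  Hence
   each constraint is reported at most 1 + min (dim, |W_q|) times.  Before the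
   first reply all scopes are (0, ..., q-1) with all relations allowed, which by
   definition of W_q is unsatisfiable only if no constraint is satisfiable.

   (b) Answer the queries of the hidden algorithm with a constraint of the union
   instance violated by the query, and stop as soon as there is none.  Such a run
   is simultaneously a run against every instance obtained by choosing one
   relation from each union.  This requires the unions to be unions of nonempty
   families, which is checked first, in s * m steps.  This is affordable: against
   m copies of one unknown relation, the hidden algorithm must query or output a
   tuple in every nonempty relation, hence uses T + 1 tuples hitting them all;
   and the membership algorithm, run on the empty union and such a tuple u, must
   inspect all the relations containing u.  Hence s - 1 <= (T + 1) * comp. *)

From Stdlib Require Import Classical.
From mathcomp Require Import all_boot perm zify.
Require Import Defs.

Set Implicit Arguments.
Unset Strict Implicit.
Unset Printing Implicit Defensive.

(** * Runs and total correctness with time bounds *)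

(** Running times are statements about programs, so both reductions are programs that execute the
    given algorithms as compiled subroutines, with constant overhead per step. Neither l nor q
    occurs in the claimed bounds: they are paid by [T], since writing out an assignment is counted
    and q is at most l. The obstacle in (b) is that a hidden algorithm is specified only against
    valid oracles of an actual instance, while it has to be run against no instance in particular.
    The way out is a device that refuses every query it cannot answer without committing itself to
    an instance. Runs on all devices extending it agree with its run up to the first refusal, and
    the refused query is the useful one: it solves the union instance, or hits the unknown relation
    in the bound on s. In the latter case the replies do not depend on the relation, so runs against
    different relations coincide until one of them is refused; this is why a single run can hit all
    nonempty relations. *)

Section Semantics.
Variables (E : Type) (io : device E).

(* [exec] extended to runs that block: the boolean is [false] if the run stops in
   front of an illegal query. *)
Inductive out : cmd -> E -> store -> bool -> E -> store -> nat -> Prop :=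
| OSkip e st : out Skip e st true e st 1
| OConst x c e st : out (Const x c) e st true e (set_var st x c) 1
| OAdd x y z e st :
    out (Add x y z) e st true e (set_var st x (var st y + var st z)) 1
| OSub x y z e st :
    out (Sub x y z) e st true e (set_var st x (var st y - var st z)) 1
| OGet x a y e st :
    out (Get x a y) e st true e (set_var st x (arr st a (var st y))) 1
| OPut a x y e st :
    out (Put a x y) e st true e (set_arr st a (var st x) (var st y)) 1
| ORead x f y z e st :
    out (Read x f y z) e st true e
      (set_var st x (io_read io e f (var st y) (var st z))) 1
| OQuery e e' st :
    io_query io e (arr st 0) = Some e' -> out Query e st true e' st 1
| OBlock e st :
    io_query io e (arr st 0) = None -> out Query e st false e st 0
| OSeq c1 c2 b e e1 e2 st st1 st2 t1 t2 :
    out c1 e st true e1 st1 t1 -> out c2 e1 st1 b e2 st2 t2 ->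
    out (Seq c1 c2) e st b e2 st2 (t1 + t2)
| OSeqBlock c1 c2 e e1 st st1 t1 :
    out c1 e st false e1 st1 t1 -> out (Seq c1 c2) e st false e1 st1 t1
| OIfTrue x c1 c2 b e e' st st' t :
    var st x != 0 -> out c1 e st b e' st' t ->
    out (If x c1 c2) e st b e' st' t.+1
| OIfFalse x c1 c2 b e e' st st' t :
    var st x == 0 -> out c2 e st b e' st' t ->
    out (If x c1 c2) e st b e' st' t.+1
| OWhileTrue x c b e e1 e2 st st1 st2 t1 t2 :
    var st x != 0 -> out c e st true e1 st1 t1 ->
    out (While x c) e1 st1 b e2 st2 t2 ->
    out (While x c) e st b e2 st2 (t1 + t2).+1
| OWhileBlock x c e e1 st st1 t1 :
    var st x != 0 -> out c e st false e1 st1 t1 ->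
    out (While x c) e st false e1 st1 t1.+1
| OWhileFalse x c e st :
    var st x == 0 -> out (While x c) e st true e st 1.

Lemma exec_out c e st e' st' t :
  exec io c e st e' st' t -> out c e st true e' st' t.
Proof. by elim=> *; econstructor; eauto. Qed.

Lemma out_exec c e st e' st' t :
  out c e st true e' st' t -> exec io c e st e' st' t.
Proof.
move=> H; have: true by [].
by elim: H => //= *; try (by econstructor; eauto).
Qed.

Lemma out_blocked c e st e' st' t :
  out c e st false e' st' t -> io_query io e' (arr st' 0) = None.
Proof.
move=> H; have: ~~ false by [].
by elim: H => //= *; eauto.
Qed.

Lemma out_det c e st b1 e1 st1 t1 b2 e2 st2 t2 :
  out c e st b1 e1 st1 t1 -> out c e st b2 e2 st2 t2 ->
  [/\ b1 = b2, e1 = e2, st1 = st2 & t1 = t2].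
Proof.
move=> H; elim: H b2 e2 st2 t2 => *;
  match goal with H : out _ _ _ _ _ _ _ |- _ => inversion H; subst end;
  repeat match goal with
  | IH : (forall b e s t, out ?c ?e0 ?s0 b e s t -> _),
    H : out ?c ?e0 ?s0 _ _ _ _ |- _ =>
      case: (IH _ _ _ _ H) => *; clear H; subst
  end;
  try match goal with
  | H : is_true (~~ ?a), H' : is_true ?a |- _ => by rewrite H' in H
  end; split; congruence.
Qed.

Lemma exec_det c e st e1 st1 t1 e2 st2 t2 :
  exec io c e st e1 st1 t1 -> exec io c e st e2 st2 t2 ->
  [/\ e1 = e2, st1 = st2 & t1 = t2].
Proof.
by move=> /exec_out H1 /exec_out H2; case: (out_det H1 H2).
Qed.

Lemma exec_gt0 c e st e' st' t : exec io c e st e' st' t -> 0 < t.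
Proof. by elim=> // *; lia. Qed.

End Semantics.

(** * Runs on a device that refuses some queries *)

Definition subdevice E (io' io : device E) :=
  [/\ forall e f y z, io_read io' e f y z = io_read io e f y z &
      forall e f e', io_query io' e f = Some e' -> io_query io e f = Some e'].

Section SubDevice.
Variables (E : Type) (io io' : device E) (le : E -> E -> Prop).
Hypothesis sub : subdevice io' io.
Hypothesis le_refl : forall e, le e e.
Hypothesis le_trans : forall e1 e2 e3, le e1 e2 -> le e2 e3 -> le e1 e3.
Hypothesis le_query : forall e f e', io_query io e f = Some e' -> le e e'.

Lemma exec_sub c e st e' st' t :
  exec io' c e st e' st' t -> exec io c e st e' st' t.
Proof.
case: sub => Hr Hq.
elim=> *; try (rewrite Hr); try (by econstructor; eauto).
Qed.

Lemma out_le c e st b e' st' t : out io c e st b e' st' t -> le e e'.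
Proof. by elim=> *; eauto. Qed.

(** Both devices behave alike up to the first query that only [io] answers. The relation [le], later
    the extension of histories, records that this query and its reply are still visible in the final
    state [e']. *)
Lemma out_sub c e st b e' st' t :
  out io c e st b e' st' t ->
  out io' c e st b e' st' t \/
  exists e1 e2 st1 t1,
    [/\ out io' c e st false e1 st1 t1, t1 <= t,
        io_query io e1 (arr st1 0) = Some e2 & le e2 e'].
Proof.
case: sub => Hr Hq.
elim=> {c e st b e' st' t}.
1-6: by left; constructor.
- by move=> *; left; rewrite -Hr; constructor.
- move=> e e' st H; case E': (io_query io' e (arr st 0)) => [e2|].
    by left; constructor; rewrite E' -H; apply/esym/Hq.
  by right; exists e, e', st, 0; split => //; constructor.
- move=> e st H; left; constructor.
  case E': (io_query _ _ _) => [e2|] //.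
  by rewrite (Hq _ _ _ E') in H.
- move=> c1 c2 b e e1 e2 st st1 st2 t1 t2 _ [I1|[x1 [x2 [y1 [u [A1 A2 A3 A4]]]]]] H2 I2.
    case: I2 => [I2|[x1 [x2 [y1 [u [A1 A2 A3 A4]]]]]].
      by left; apply: OSeq I2.
    right; exists x1, x2, y1, (t1 + u); split => //; last by rewrite leq_add2l.
    exact: OSeq A1.
  right; exists x1, x2, y1, u; split => //.
  - exact: OSeqBlock.
  - exact: leq_trans A2 (leq_addr _ _).
  - exact: le_trans A4 (out_le H2).
- move=> c1 c2 e e1 st st1 t1 _ [I1|[x1 [x2 [y1 [u [A1 A2 A3 A4]]]]]].
    by left; apply: OSeqBlock.
  by right; exists x1, x2, y1, u; split => //; apply: OSeqBlock.
- move=> x c1 c2 b e e' st st' t Hx _ [I1|[x1 [x2 [y1 [u [A1 A2 A3 A4]]]]]].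
    by left; apply: OIfTrue.
  by right; exists x1, x2, y1, u.+1; split => //; apply: OIfTrue.
- move=> x c1 c2 b e e' st st' t Hx _ [I1|[x1 [x2 [y1 [u [A1 A2 A3 A4]]]]]].
    by left; apply: OIfFalse.
  by right; exists x1, x2, y1, u.+1; split => //; apply: OIfFalse.
- move=> x c b e e1 e2 st st1 st2 t1 t2 Hx _ [I1|[x1 [x2 [y1 [u [A1 A2 A3 A4]]]]]] H2 I2.
    case: I2 => [I2|[x1 [x2 [y1 [u [A1 A2 A3 A4]]]]]].
      by left; apply: OWhileTrue I2.
    right; exists x1, x2, y1, (t1 + u).+1; split => //; last by rewrite ltnS leq_add2l.
    exact: OWhileTrue A1.
  right; exists x1, x2, y1, u.+1; split => //.
  - exact: OWhileBlock.
  - by rewrite ltnS (leq_trans A2) // leq_addr.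
  - exact: le_trans A4 (out_le H2).
- move=> x c e e1 st st1 t1 Hx _ [I1|[x1 [x2 [y1 [u [A1 A2 A3 A4]]]]]].
    by left; apply: OWhileBlock.
  by right; exists x1, x2, y1, u.+1; split => //; apply: OWhileBlock.
- by move=> *; left; constructor.
Qed.

End SubDevice.

(** A run of [t] steps inspects at most [t] cells, so changing the others goes unnoticed. Only field
    1, which holds the name of a relation in the membership problem, is allowed to differ; its cells
    are identified by their first address, the second one being ignored there. *)
Lemma exec_reads E (io : device E) c e st e' st' t :
  exec io c e st e' st' t ->
  exists2 L : seq nat, size L <= t &
    forall io' : device E,
    (forall e, io_query io' e =1 io_query io e) ->
    (forall e f y z, (f == 1) ==> (y \in L) ->
       io_read io' e f y z = io_read io e f y z) ->
    exec io' c e st e' st' t.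
Proof.
elim=> {c e st e' st' t}.
1-6: by exists [::] => // *; constructor.
- move=> x f y z e st; exists [:: var st y] => // io' _ H.
  by rewrite -H ?inE ?eqxx ?implybT //; constructor.
- by move=> e e' st H; exists [::] => // io' Hq _; constructor; rewrite Hq.
- move=> c1 c2 e e1 e2 st st1 st2 t1 t2 _ [L1 S1 H1] _ [L2 S2 H2].
  exists (L1 ++ L2) => [|io' Hq Hr]; first by rewrite size_cat leq_add.
  apply: ESeq (H1 _ _ _) (H2 _ _ _) => // e0 f y z Hf; apply: Hr;
    by case: (f == 1) Hf => //=; rewrite mem_cat => ->; rewrite ?orbT.
- move=> x c1 c2 e e' st st' t Hx _ [L S H].
  by exists L => [|io' Hq Hr]; [apply: leq_trans S _ | apply: EIfTrue => //; apply: H].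
- move=> x c1 c2 e e' st st' t Hx _ [L S H].
  by exists L => [|io' Hq Hr]; [apply: leq_trans S _ | apply: EIfFalse => //; apply: H].
- move=> x c e e1 e2 st st1 st2 t1 t2 Hx _ [L1 S1 H1] _ [L2 S2 H2].
  exists (L1 ++ L2) => [|io' Hq Hr]; first by rewrite size_cat leqW // leq_add.
  apply: EWhileTrue (H1 _ _ _) (H2 _ _ _) => // e0 f y z Hf; apply: Hr;
    by case: (f == 1) Hf => //=; rewrite mem_cat => ->; rewrite ?orbT.
- by move=> x c e st Hx; exists [::] => // *; constructor.
Qed.

(** * Straight-line code and loops with step bounds *)

Fixpoint simple (c : cmd) : bool :=
  match c with
  | Seq c1 c2 | If _ c1 c2 => simple c1 && simple c2
  | Query | While _ _ => false
  | _ => true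
  end.

Fixpoint cost (c : cmd) : nat :=
  match c with
  | Seq c1 c2 => cost c1 + cost c2
  | If _ c1 c2 => (maxn (cost c1) (cost c2)).+1
  | _ => 1
  end.

Section Triples.
Variables (E : Type) (io : device E).

Fixpoint ev (e : E) (c : cmd) (st : store) : store :=
  match c with
  | Const x k => set_var st x k
  | Add x y z => set_var st x (var st y + var st z)
  | Sub x y z => set_var st x (var st y - var st z)
  | Get x a y => set_var st x (arr st a (var st y))
  | Put a x y => set_arr st a (var st x) (var st y)
  | Read x f y z => set_var st x (io_read io e f (var st y) (var st z))
  | Seq c1 c2 => ev e c2 (ev e c1 st)
  | If x c1 c2 => if var st x != 0 then ev e c1 st else ev e c2 st
  | _ => st
  end.

Definition tri c e st b (Q : E -> store -> Prop) :=
  exists e' st' t, [/\ exec io c e st e' st' t, t <= b & Q e' st'].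

Lemma tri_weak c e st b b' (Q Q' : E -> store -> Prop) :
  tri c e st b Q -> b <= b' -> (forall e' st', Q e' st' -> Q' e' st') ->
  tri c e st b' Q'.
Proof.
move=> [e' [st' [t [H1 H2 H3]]]] Hb HQ.
by exists e', st', t; split; [|apply: leq_trans Hb|apply: HQ].
Qed.

Lemma tri_simple c e st b (Q : E -> store -> Prop) :
  simple c -> cost c <= b -> Q e (ev e c st) -> tri c e st b Q.
Proof.
move=> Hs Hb HQ.
suff [t H1 H2]: exists2 t, exec io c e st e (ev e c st) t & t <= cost c.
  by exists e, (ev e c st), t; split => //; apply: leq_trans Hb.
move: Hs => {Hb HQ}; elim: c st => //=.
1-7: by move=> *; exists 1 => //; constructor.
- move=> c1 IH1 c2 IH2 st /andP [/(IH1 st) [t1 A1 B1] /(IH2 (ev e c1 st)) [t2 A2 B2]].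
  by exists (t1 + t2); [apply: ESeq A1 A2 | apply: leq_add].
- move=> x c1 IH1 c2 IH2 st /andP [/(IH1 st) [t1 A1 B1] /(IH2 st) [t2 A2 B2]].
  case: ifPn => Hx.
    by exists t1.+1; [apply: EIfTrue | rewrite ltnS (leq_trans B1) ?leq_maxl].
  exists t2.+1; last by rewrite ltnS (leq_trans B2) ?leq_maxr.
  by apply: EIfFalse => //; rewrite -[_ == _]negbK.
Qed.

Lemma tri_seq c1 c2 e st b1 b2 (Q : E -> store -> Prop) :
  tri c1 e st b1 (fun e1 st1 => tri c2 e1 st1 b2 Q) ->
  tri (Seq c1 c2) e st (b1 + b2) Q.
Proof.
move=> [e1 [st1 [t1 [H1 B1 [e2 [st2 [t2 [H2 B2 HQ]]]]]]]].
by exists e2, st2, (t1 + t2); split => //; [apply: ESeq H1 H2 | apply: leq_add].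
Qed.

Lemma tri_if x c1 c2 e st b (Q : E -> store -> Prop) :
  (var st x != 0 -> tri c1 e st b Q) -> (var st x = 0 -> tri c2 e st b Q) ->
  tri (If x c1 c2) e st b.+1 Q.
Proof.
move=> H1 H2; have [Hx|Hx] := eqVneq (var st x) 0.
  have [e' [st' [t [A B C]]]] := H2 Hx.
  by exists e', st', t.+1; split => //; apply: EIfFalse => //; rewrite Hx.
have [e' [st' [t [A B C]]]] := H1 Hx.
by exists e', st', t.+1; split => //; apply: EIfTrue.
Qed.

(** There are at most [mu + 1] iterations: [mu] that lower the measure and one that leaves the loop.
    The leaving iteration owes only [Q], so a loop that stops on success need not restore its
    invariant. *)
Lemma tri_while x c b (I : nat -> E -> store -> Prop) (Q : E -> store -> Prop)
    mu e st :
  (forall mu e st, I mu e st -> var st x != 0 ->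
     tri c e st b (fun e' st' =>
       (var st' x = 0 /\ Q e' st') \/
       (exists2 mu', mu' < mu & I mu' e' st'))) ->
  (forall mu e st, I mu e st -> var st x = 0 -> Q e st) ->
  I mu e st ->
  tri (While x c) e st (mu.+1 * (b + 1) + 1) Q.
Proof.
move=> Hc H0; elim/ltn_ind: mu e st => mu IH e st HI.
have [Hx|Hx] := eqVneq (var st x) 0.
  exists e, st, 1; split; [|by lia|exact: H0 HI Hx].
  by apply: EWhileFalse; rewrite Hx.
have [e' [st' [t [A B [[Hz HQ]|[mu' Hmu HI']]]]]] := Hc _ _ _ HI Hx.
  exists e', st', (t + 1).+1; split => //; last by lia.
  by apply: EWhileTrue A _ => //; apply: EWhileFalse; rewrite Hz.
have [e2 [st2 [t2 [A2 B2 HQ]]]] := IH _ Hmu _ _ HI'.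
exists e2, st2, (t + t2).+1; split => //; last by nia.
exact: EWhileTrue A A2.
Qed.

(** The guard [g] holds the remaining count [n - i], and in between the constant 1 needed to
    increment [i]. This bookkeeping and the loop test make up the 4 extra steps per iteration in the
    bound below. *)
Definition For g i n body : cmd :=
  Seq (Const i 0) (Seq (Sub g n i)
    (While g (Seq body (Seq (Const g 1) (Seq (Add i i g) (Sub g n i)))))).

Lemma tri_for g i n body N b (I : nat -> E -> store -> Prop) e st :
  g != i -> g != n -> i != n ->
  (forall k e st v, I k e st -> I k e (set_var st g v)) ->
  (forall k e st v, I k e st -> I k e (set_var st i v)) ->
  (forall k e st, k < N -> var st i = k -> var st n = N -> I k e st ->
     tri body e st b (fun e' st' =>
       [/\ var st' i = k, var st' n = N & I k.+1 e' st'])) ->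
  var st n = N -> I 0 e st ->
  tri (For g i n body) e st (N.+1 * (b + 4) + 3) (fun e' st' =>
    var st' n = N /\ I N e' st').
Proof.
move=> gi gn ni Ig Ii Hb Hn H0.
have E1 (s : store) x v : var (set_var s x v) x = v by rewrite /= /upd eqxx.
have E2 (s : store) x y v : x != y -> var (set_var s x v) y = var s y.
  by move=> xy; rewrite /= /upd eq_sym (negPf xy).
have ig : i != g by rewrite eq_sym.
pose J mu e0 s := exists k, [/\ mu + k = N, var s i = k, var s n = N,
  var s g = N - k & I k e0 s].
have W : tri (While g (Seq body (Seq (Const g 1) (Seq (Add i i g) (Sub g n i))))) e
    (set_var (set_var st i 0) g N) (N.+1 * ((b + 3) + 1) + 1)
    (fun e' st' => var st' n = N /\ I N e' st').
  apply: (@tri_while _ _ _ J).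
  - move=> mu e0 s [k [Hmu Hi Hn' Hg HI]] Hnz.
    have kN : k < N by lia.
    apply: tri_seq; apply: tri_weak (Hb k e0 s kN Hi Hn' HI) (leqnn _) _.
    move=> e1 s1 [A1 A2 A3]; apply: tri_simple => //; right; exists mu.-1; first by lia.
    exists k.+1; rewrite /ev !(E1, E2 _ _ _ _ gi, E2 _ _ _ _ gn, E2 _ _ _ _ ni, E2 _ _ _ _ ig).
    rewrite A1 A2 addn1; split => //; first by lia.
    exact: Ig (Ii _ _ _ _ (Ig _ _ _ _ A3)).
  - move=> mu e0 s [k [Hmu Hi Hn' Hg HI]] Hz; split => //.
    by have -> : N = k by lia.
  - exists 0.
    rewrite !(E1, E2 _ _ _ _ gi, E2 _ _ _ _ gn, E2 _ _ _ _ ni, E2 _ _ _ _ ig) addn0 subn0; split => //.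
    exact: Ig (Ii _ _ _ _ H0).
have HB : 1 + (1 + (N.+1 * ((b + 3) + 1) + 1)) <= N.+1 * (b + 4) + 3.
  by rewrite -(addnA b 3 1) addnA addnC -addnA.
refine (tri_weak _ HB (fun _ _ H => H)).
apply: tri_seq; apply: tri_simple => //; apply: tri_seq; apply: tri_simple => //.
by rewrite /ev E1 (E2 _ _ _ _ ni) Hn subn0.
Qed.

End Triples.

(** * Simulating a program by another one *)

(* Registers and arrays are allocated by residue mod 3: class 0 is the main
   program, classes [r] = 1, 2 are simulated programs.  In class [r], [tv r 0] is
   a flag set to abort the simulation, [tv r 1] the current epoch, [tv r i] with
   2 <= i < 8 are temporaries, and [xv r x] is the simulated variable [x]. *)
Definition tv (r i : nat) : nat := 3 * i + r.
Definition xv (r x : nat) : nat := 3 * (x + 8) + r.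
Definition va (r a : nat) : nat := 3 * a.*2 + r.
Definition sa (r a : nat) : nat := 3 * a.*2.+1 + r.

(* A simulated array cell counts as 0 unless its stamp, in the array [sa r a], is
   the current epoch; so incrementing the epoch clears all the arrays at once. *)
Definition sget (r : nat) (st : store) (a i : nat) : nat :=
  if var st (tv r 1) - arr st (sa r a) i == 0 then arr st (va r a) i else 0.

Definition geta (r t x a y : nat) : cmd :=
  Seq (Get t (sa r a) y) (Seq (Sub t (tv r 1) t)
    (If t (Const x 0) (Get x (va r a) y))).

Definition ready (r : nat) (st : store) : Prop :=
  var st (tv r 0) = 0 /\ forall a i, arr st (sa r a) i <= var st (tv r 1).

Definition same (r : nat) (st st' : store) : Prop :=
  (forall x, x %% 3 != r -> var st' x = var st x) /\
  (forall a i, a %% 3 != r -> arr st' a i = arr st a i).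

(** Registers from [N] on are left unconstrained: a reset zeroes only finitely many registers,
    enough for the program that is run, whereas the stamps take care of all arrays. *)
Definition sim (r N : nat) (sst st : store) : Prop :=
  [/\ forall x, x < N -> var st (xv r x) = var sst x,
      forall a i, arr sst a i = sget r st a i & ready r st].

Lemma updE f i v j : upd f i v j = if j == i then v else f j.
Proof. by []. Qed.

Lemma var_set st x v y : var (set_var st x v) y = if y == x then v else var st y.
Proof. by []. Qed.

Lemma arr_set_var st x v : arr (set_var st x v) = arr st.
Proof. by []. Qed.

Lemma var_set_arr st a i v : var (set_arr st a i v) = var st.
Proof. by []. Qed.

Lemma arr_set st a i v b j :
  arr (set_arr st a i v) b j =
  if (b == a) && (j == i) then v else arr st b j.
Proof. by rewrite /=; case: eqP => //= ->. Qed.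

Lemma same_trans r st1 st2 st3 : same r st1 st2 -> same r st2 st3 -> same r st1 st3.
Proof.
move=> [A1 A2] [B1 B2]; split=> [x Hx|a i Ha]; first by rewrite B1 ?A1.
by rewrite B2 ?A2.
Qed.

Lemma same_set r st st' x v : x %% 3 == r -> same r st st' -> same r st (set_var st' x v).
Proof.
move=> Hx [A1 A2]; split => // y Hy; rewrite var_set A1 //.
by case: eqP => // E; rewrite E Hx in Hy.
Qed.

Lemma same_put r st st' a i v : a %% 3 == r -> same r st st' -> same r st (set_arr st' a i v).
Proof.
move=> Ha [A1 A2]; split => // b j Hb; rewrite arr_set A2 //.
by case: eqP => // E; rewrite E Ha in Hb.
Qed.

Lemma tv_mod r i : r < 3 -> tv r i %% 3 == r.
Proof. rewrite /tv; lia. Qed.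
Lemma xv_mod r i : r < 3 -> xv r i %% 3 == r.
Proof. rewrite /xv; lia. Qed.
Lemma va_mod r i : r < 3 -> va r i %% 3 == r.
Proof. rewrite /va; lia. Qed.
Lemma sa_mod r i : r < 3 -> sa r i %% 3 == r.
Proof. rewrite /sa; lia. Qed.

Lemma sget_same r r' st st' a i :
  r < 3 -> r' < 3 -> r != r' -> same r st st' -> sget r' st' a i = sget r' st a i.
Proof.
move=> r3 r3' rr' [A1 A2]; rewrite /sget A1 ?A2 //; rewrite /tv /sa /va; lia.
Qed.

Lemma ready_same r r' st st' :
  r < 3 -> r' < 3 -> r != r' -> same r st st' -> ready r' st -> ready r' st'.
Proof.
move=> r3 r3' rr' [A1 A2] [B1 B2]; split.
  by rewrite A1 // /tv; lia.
by move=> a i; rewrite A1 ?A2 //; rewrite /tv /sa; lia.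
Qed.

Lemma sim_same r r' N sst st st' :
  r < 3 -> r' < 3 -> r != r' -> same r st st' -> sim r' N sst st -> sim r' N sst st'.
Proof.
move=> r3 r3' rr' S [B1 B2 B3]; split.
- by move=> x Hx; rewrite -B1 // (proj1 S) // /xv; lia.
- by move=> a i; rewrite (sget_same _ _ _ _ _ S).
- exact: ready_same S B3.
Qed.

Lemma sim_temp r N sst st x v :
  (x %% 3 != r) || (tv r 2 <= x < xv r 0) -> r < 3 -> sim r N sst st ->
  sim r N sst (set_var st x v).
Proof.
rewrite /tv /xv => Hx r3 [B1 B2 [B3 B4]].
have e0 : (tv r 0 == x) = false by rewrite /tv; lia.
have e1 : (tv r 1 == x) = false by rewrite /tv; lia.
split.
- by move=> y Hy; rewrite var_set -B1 //; case: eqP => // E; rewrite /xv in E; lia.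
- by move=> a i; rewrite B2 /sget var_set e1.
- by split=> [|a i]; rewrite var_set ?e0 ?e1 //; apply: B4.
Qed.

Lemma sim_tmp r N sst st i v :
  r < 3 -> 2 <= i < 8 -> sim r N sst st -> sim r N sst (set_var st (tv r i) v).
Proof. by move=> r3 Hi; apply: sim_temp; rewrite // /tv /xv; lia. Qed.

Lemma sim_set r N sst st x v :
  r < 3 -> sim r N sst st -> sim r N (set_var sst x v) (set_var st (xv r x) v).
Proof.
move=> r3 [B1 B2 [B3 B4]].
have e0 : (tv r 0 == xv r x) = false by rewrite /tv /xv; lia.
have e1 : (tv r 1 == xv r x) = false by rewrite /tv /xv; lia.
split.
- move=> y Hy; rewrite !var_set B1 //.
  by have -> : (xv r y == xv r x) = (y == x) by rewrite /xv; lia.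
- by move=> a i; rewrite arr_set_var B2 /sget var_set e1.
- by split=> [|a i]; rewrite var_set ?e0 ?e1 //; apply: B4.
Qed.

Lemma sim_put r N sst st a i v :
  r < 3 -> sim r N sst st ->
  sim r N (set_arr sst a i v)
    (set_arr (set_arr st (va r a) i v) (sa r a) i (var st (tv r 1))).
Proof.
move=> r3 [B1 B2 [B3 B4]]; split => //.
- move=> b j; rewrite /sget var_set_arr !arr_set B2 /sget var_set_arr.
  have -> : (sa r b == sa r a) = (b == a) by rewrite /sa; lia.
  have -> : (va r b == va r a) = (b == a) by rewrite /va; lia.
  have -> : (va r b == sa r a) = false by rewrite /va /sa; lia.
  have -> : (sa r b == va r a) = false by rewrite /va /sa; lia.
  by case: andP => //= _; rewrite subnn.
- split=> // b j; rewrite var_set_arr !arr_set.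
  have -> : (sa r b == va r a) = false by rewrite /va /sa; lia.
  case: andP => _ //; exact: B4.
Qed.

Lemma sim_get r N sst st a i : sim r N sst st -> arr sst a i = sget r st a i.
Proof. by case. Qed.

Fixpoint size_cmd (c : cmd) : nat :=
  match c with
  | Seq c1 c2 | If _ c1 c2 => (size_cmd c1 + size_cmd c2).+1
  | While _ c => (size_cmd c).+1
  | _ => 1
  end.

Fixpoint vbound (c : cmd) : nat :=
  match c with
  | Skip | Query => 1
  | Const x _ => x.+1
  | Add x y z | Sub x y z => (maxn x (maxn y z)).+1
  | Get x _ y | Put _ x y => (maxn x y).+1
  | Read x _ y z => (maxn x (maxn y z)).+1
  | Seq c1 c2 => maxn (vbound c1) (vbound c2)
  | If x c1 c2 => maxn x.+1 (maxn (vbound c1) (vbound c2))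
  | While x c => maxn x.+1 (vbound c)
  end.

Section Compile.
Variables (r : nat) (rd : nat -> nat -> nat -> nat -> cmd) (qm : cmd).

(** An abort cannot jump: the flag is tested between the halves of a sequence and after a loop body,
    and a loop is left by zeroing its guard register. *)
Fixpoint compile (c : cmd) : cmd :=
  match c with
  | Skip => Skip
  | Const x k => Const (xv r x) k
  | Add x y z => Add (xv r x) (xv r y) (xv r z)
  | Sub x y z => Sub (xv r x) (xv r y) (xv r z)
  | Get x a y => geta r (tv r 2) (xv r x) a (xv r y)
  | Put a x y => Seq (Put (va r a) (xv r x) (xv r y))
                     (Put (sa r a) (xv r x) (tv r 1))
  | Read x f y z => rd (xv r x) f (xv r y) (xv r z)
  | Query => qm
  | Seq c1 c2 => Seq (compile c1) (If (tv r 0) Skip (compile c2))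
  | If x c1 c2 => If (xv r x) (compile c1) (compile c2)
  | While x c => While (xv r x)
      (Seq (compile c) (If (tv r 0) (Const (xv r x) 0) Skip))
  end.

Variables (E1 E2 : Type) (io1 : device E1) (io2 : device E2).
Variables (N : nat) (C : nat).
Variable Inv : E1 -> E2 -> store -> Prop.
Variable Stop : E1 -> store -> E2 -> store -> Prop.
Variable Blk : E1 -> store -> Prop.
Hypothesis r3 : r < 3.
Hypothesis C8 : 8 <= C.
Hypothesis Inv_same : forall e e2 st st', same r st st' -> Inv e e2 st -> Inv e e2 st'.
Hypothesis Stop_set : forall e sst e2 st x v,
  Stop e sst e2 st -> Stop e sst e2 (set_var st (xv r x) v).
Hypothesis Hrd : forall x f y z e sst e2 st,
  x < N -> y < N -> z < N -> sim r N sst st -> Inv e e2 st ->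
  exists st' k, [/\ exec io2 (rd (xv r x) f (xv r y) (xv r z)) e2 st e2 st' k,
    k < C, same r st st' &
    sim r N (set_var sst x (io_read io1 e f (var sst y) (var sst z))) st'].
Hypothesis HqT : forall e e' sst e2 st, sim r N sst st -> Inv e e2 st ->
  io_query io1 e (arr sst 0) = Some e' ->
  exists e2' st' k, [/\ exec io2 qm e2 st e2' st' k, k < C, sim r N sst st' &
    Inv e' e2' st'].
Hypothesis HqF : forall e sst e2 st, sim r N sst st -> Inv e e2 st -> Blk e sst ->
  exists e2' st' k, [/\ exec io2 qm e2 st e2' st' k, k < C,
    var st' (tv r 0) != 0 & Stop e sst e2' st'].

Lemma simple_step c e2 st sst' e :
  simple c -> cost c <= 5 -> Inv e e2 st -> same r st (ev io2 e2 c st) ->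
  sim r N sst' (ev io2 e2 c st) ->
  exists e2' st' k, [/\ exec io2 c e2 st e2' st' k, k.+1 <= C * 1 &
    sim r N sst' st' /\ Inv e e2' st'].
Proof.
move=> Hs Hc HI HS Hsim.
have [e' [st' [k [A B [Q1 Q2]]]]] : tri io2 c e2 st 5
    (fun e' st' => sim r N sst' st' /\ Inv e e' st').
  by apply: tri_simple => //; split => //; apply: Inv_same HI.
by exists e', st', k; split => //; lia.
Qed.

(** The spare step in [k.+1] pays for the flag test that may follow. In an aborted run the refused
    query is free in [out] but costs up to [C] here, whence [t.+1]; afterwards each enclosing
    construct is left once, which [4 * size_cmd c] covers. *)
Lemma simulation c e sst b e' sst' t : out io1 c e sst b e' sst' t ->
  (b \/ Blk e' sst') -> forall e2 st, vbound c <= N -> sim r N sst st -> Inv e e2 st ->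
  exists e2' st' k,
    [/\ exec io2 (compile c) e2 st e2' st' k,
        if b then k.+1 <= C * t else k <= C * t.+1 + 4 * size_cmd c &
        if b then sim r N sst' st' /\ Inv e' e2' st'
        else var st' (tv r 0) != 0 /\ Stop e' sst' e2' st'].
Proof.
elim=> {c e sst b e' sst' t}.
- by move=> e sst _ e2 st _ Hs HI; apply: simple_step.
- move=> x c e sst _ e2 st _ Hs HI; apply: simple_step => //.
    by apply: same_set => //; apply: xv_mod.
  exact: sim_set.
- move=> x y z e sst _ e2 st /= Hb Hs HI; apply: simple_step => //.
    by apply: same_set => //; apply: xv_mod.
  by case: (Hs) => Hv _ _; rewrite /ev !Hv; [apply: sim_set|lia|lia].
- move=> x y z e sst _ e2 st /= Hb Hs HI; apply: simple_step => //.
    by apply: same_set => //; apply: xv_mod.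
  by case: (Hs) => Hv _ _; rewrite /ev !Hv; [apply: sim_set|lia|lia].
- move=> x a y e sst _ e2 st /= Hb Hs HI.
  have hy : y < N by lia.
  have n1 : (xv r y == tv r 2) = false by rewrite /xv /tv; lia.
  have n2 : (tv r 1 == tv r 2) = false by rewrite /tv; lia.
  have Hv : var st (xv r y) = var sst y by case: Hs => ->.
  apply: simple_step => //.
    rewrite /geta /ev; case: ifP => _; do !apply: same_set => //; rewrite ?xv_mod ?tv_mod //.
  rewrite /geta /ev !var_set !eqxx n1 n2 Hv (sim_get _ _ Hs) /sget.
  by case: eqP => _ /=; rewrite ?updE ?n1 ?Hv; apply: sim_set => //;
    do !apply: sim_tmp => //.
- move=> a x y e sst _ e2 st /= Hb Hs HI.
  have hx : x < N by lia.
  have hy : y < N by lia.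
  apply: simple_step => //.
    by do !apply: same_put => //; rewrite ?va_mod ?sa_mod.
  by case: (Hs) => Hv _ _; rewrite /ev var_set_arr !Hv //; apply: sim_put.
- move=> x f y z e sst _ e2 st /= Hb Hs HI.
  have hx : x < N by lia.
  have hy : y < N by lia.
  have hz : z < N by lia.
  have [st' [k [A B D F]]] := Hrd f hx hy hz Hs HI.
  by exists e2, st', k; rewrite muln1; split => //; split => //; apply: Inv_same HI.
- move=> e e' sst Hq _ e2 st _ Hs HI.
  have [e2' [st' [k [A B D F]]]] := HqT Hs HI Hq.
  by exists e2', st', k; rewrite muln1.
- move=> e sst _ [//|Hb] e2 st _ Hs HI.
  have [e2' [st' [k [A B D F]]]] := HqF Hs HI Hb.
  by exists e2', st', k; split => //; lia.
- move=> c1 c2 b e e1 e' sst sst1 sst2 t1 t2 _ IH1 _ IH2 Hbl e2 st /= Hb Hs HI.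
  have [|e3 [st1 [k1 [A1 B1 [D1 F1]]]]] := IH1 (or_introl isT) e2 st _ Hs HI; first by lia.
  have [|e4 [st2 [k2 [A2 B2 D2]]]] := IH2 Hbl e3 st1 _ D1 F1; first by lia.
  exists e4, st2, (k1 + k2.+1); split => //.
    by apply: ESeq A1 _; apply: EIfFalse A2; case: D1 => _ _ [-> _].
  by case: b B2 {D2 IH2 Hbl} => B2; nia.
- move=> c1 c2 e e1 sst sst1 t1 _ IH1 Hbl e2 st /= Hb Hs HI.
  have [|e3 [st1 [k1 [A1 B1 [D1 F1]]]]] := IH1 Hbl e2 st _ Hs HI; first by lia.
  exists e3, st1, (k1 + 2); split => //; last by lia.
  by apply: ESeq A1 _; apply: EIfTrue => //; constructor.
- move=> x c1 c2 b e e' sst sst' t Hx _ IH Hbl e2 st /= Hb Hs HI.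
  have [|e3 [st1 [k1 [A1 B1 D1]]]] := IH Hbl e2 st _ Hs HI; first by lia.
  exists e3, st1, k1.+1; split => //.
    by apply: EIfTrue A1; case: (Hs) => ->; rewrite //; lia.
  by case: b B1 {D1 IH Hbl} => B1; nia.
- move=> x c1 c2 b e e' sst sst' t Hx _ IH Hbl e2 st /= Hb Hs HI.
  have [|e3 [st1 [k1 [A1 B1 D1]]]] := IH Hbl e2 st _ Hs HI; first by lia.
  exists e3, st1, k1.+1; split => //.
    by apply: EIfFalse A1; case: (Hs) => ->; rewrite //; lia.
  by case: b B1 {D1 IH Hbl} => B1; nia.
- move=> x c b e e1 e' sst sst1 sst2 t1 t2 Hx _ IH1 _ IH2 Hbl e2 st /= Hb Hs HI.
  have [|e3 [st1 [k1 [A1 B1 [D1 F1]]]]] := IH1 (or_introl isT) e2 st _ Hs HI; first by lia.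
  have [|e4 [st2 [k2 [A2 B2 D2]]]] := IH2 Hbl e3 st1 _ D1 F1; first by [].
  exists e4, st2, ((k1 + 2) + k2).+1; split => //.
    apply: EWhileTrue A2; first by case: (Hs) => ->; rewrite //; lia.
    by apply: ESeq A1 _; apply: EIfFalse; [case: D1 => _ _ [-> _] | constructor].
  by case: b B2 {D2 IH2 Hbl} => /= B2; nia.
- move=> x c e e1 sst sst1 t1 Hx _ IH1 Hbl e2 st /= Hb Hs HI.
  have [|e3 [st1 [k1 [A1 B1 [D1 F1]]]]] := IH1 Hbl e2 st _ Hs HI; first by lia.
  exists e3, (set_var st1 (xv r x) 0), ((k1 + 2) + 1).+1; split => //; last first.
  + split; last exact: Stop_set.
    by rewrite var_set; have -> : (tv r 0 == xv r x) = false by rewrite /tv /xv; lia.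
  + by lia.
  apply: EWhileTrue; first by case: (Hs) => ->; rewrite //; lia.
    by apply: ESeq A1 _; apply: EIfTrue => //; constructor.
  by apply: EWhileFalse; rewrite var_set eqxx.
- move=> x c e sst Hx _ e2 st /= Hb Hs HI.
  exists e2, st, 1; split => //; last by lia.
  by apply: EWhileFalse; case: (Hs) => ->; rewrite //; lia.
Qed.

End Compile.

Fixpoint clear_vars (r N : nat) : cmd :=
  if N is N'.+1 then Seq (clear_vars r N') (Const (xv r N') 0) else Skip.

Definition reset (r N : nat) : cmd :=
  Seq (Const (tv r 2) 1) (Seq (Add (tv r 1) (tv r 1) (tv r 2)) (clear_vars r N)).

Lemma reset_run E (io : device E) r N e st :
  r < 3 -> ready r st ->
  tri io (reset r N) e st (N + 3) (fun e' st' =>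
    [/\ e' = e, same r st st' & sim r N store0 st']).
Proof.
move=> r3 [H0 Hs].
have clr M s : let s' := ev io e (clear_vars r M) s in
    [/\ simple (clear_vars r M), cost (clear_vars r M) = M.+1, arr s' = arr s &
        forall y, var s' y = if [exists x : 'I_M, y == xv r x] then 0 else var s y].
  elim: M s => [|M IH] s /=.
    by split => // y; case: existsP => // - [[]].
  have [-> -> -> IHv] := IH s; split => //; first by rewrite addn1.
  move=> y; rewrite updE IHv; case: eqP => [->|ne].
    by case: existsP => // - []; exists ord_max.
  case: existsP => [[x /eqP ->]|H].
    by case: existsP => // - []; exists (widen_ord (leqnSn M) x).
  case: existsP => // - [x /eqP E0]; case: H.
  have xM : x < M.
    by have := ltn_ord x; rewrite ltnS leq_eqVlt => /orP [/eqP E1|//]; rewrite E0 E1 in ne.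
  by exists (Ordinal xM); rewrite E0.
have [Hsi Hc _ _] := clr N st.
apply: tri_simple => //=; first by rewrite Hc; lia.
set st1 := set_var _ _ _; have [_ _ Ha Hv] := clr N st1; split => //.
- split=> [x Hx|a i Ha']; last by rewrite Ha.
  rewrite Hv; case: existsP => [[y /eqP E0]|_].
    by move: (xv_mod y r3) Hx; rewrite E0 => /eqP ->; rewrite eqxx.
  rewrite /st1 !var_set; do !case: eqP => [E0|_] //;
    by move: Hx; rewrite E0 (eqP (tv_mod _ r3)) eqxx.
- have e1 : var (ev io e (clear_vars r N) st1) (tv r 1) = (var st (tv r 1)).+1.
    rewrite Hv; case: existsP => [[y]|_]; first by rewrite /tv /xv; lia.
    rewrite /st1 !var_set !eqxx !updE.
    have -> : (tv r 1 == tv r 2) = false; [by rewrite /tv; lia | by rewrite ?eqxx; lia].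
  split.
  + by move=> x Hx; rewrite Hv; case: existsP => // - []; exists (Ordinal Hx).
  + by move=> a i; rewrite /sget e1 Ha subn_eq0 leqNgt ltnS Hs.
  + split; last by move=> a i; rewrite e1 Ha (leq_trans (Hs _ _)).
    rewrite Hv; case: existsP => [[y]|_]; first by rewrite /tv /xv; lia.
    rewrite /st1 !var_set.
    have -> : (tv r 0 == tv r 1) = false by rewrite /tv; lia.
    by have -> : (tv r 0 == tv r 2) = false by rewrite /tv; lia.
Qed.

(** For subroutines without queries, which are never aborted. Their input is encoded in the host
    store outside class [r], which the simulation leaves intact; hence [rd] has to be correct only
    on stores that agree with [st0] there. *)
Lemma run_program E1 E2 (io1 : device E1) (io2 : device E2) r rd C c e sst' t e' e2 st0 :
  r < 3 -> 8 <= C -> (forall e f, io_query io1 e f = None) ->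
  (forall N x f y z sst st,
    x < N -> y < N -> z < N -> sim r N sst st -> same r st0 st ->
    exists st' k, [/\ exec io2 (rd (xv r x) f (xv r y) (xv r z)) e2 st e2 st' k,
      k < C, same r st st' &
      sim r N (set_var sst x (io_read io1 e f (var sst y) (var sst z))) st']) ->
  ready r st0 -> exec io1 c e store0 e' sst' t ->
  tri io2 (Seq (reset r (vbound c)) (compile r rd Skip c)) e2 st0
    ((vbound c).+3 + C * t) (fun e2' st' =>
    [/\ e2' = e2, same r st0 st' & sim r (vbound c) sst' st']).
Proof.
move=> r3 C8 Hq Hrd Hr Hex.
rewrite -addn3; apply: tri_seq; apply: tri_weak (reset_run io2 (vbound c) e2 r3 Hr) (leqnn _) _.
move=> _ st1 [-> S1 Hs1].
pose Inv (x : E1) y st := [/\ x = e, y = e2 & same r st0 st].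
have HI e4 e5 s s' : same r s s' -> Inv e4 e5 s -> Inv e4 e5 s'.
  by move=> S [-> -> S']; split => //; apply: same_trans S.
have Hrd' x f y z e4 sst e5 s : x < vbound c -> y < vbound c -> z < vbound c ->
    sim r (vbound c) sst s -> Inv e4 e5 s ->
    exists st' k, [/\ exec io2 (rd (xv r x) f (xv r y) (xv r z)) e5 s e5 st' k,
      k < C, same r s st' &
      sim r (vbound c) (set_var sst x (io_read io1 e4 f (var sst y) (var sst z))) st'].
  by move=> hx hy hz Hs [-> -> S]; apply: Hrd.
have HqT e4 e5 sst e6 s : sim r (vbound c) sst s -> Inv e4 e6 s ->
    io_query io1 e4 (arr sst 0) = Some e5 ->
    exists e2' st' k, [/\ exec io2 Skip e6 s e2' st' k, k < C,
      sim r (vbound c) sst st' & Inv e5 e2' st'].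
  by rewrite Hq.
have HqF e4 sst e6 s : sim r (vbound c) sst s -> Inv e4 e6 s -> False ->
    exists e2' st' k, [/\ exec io2 Skip e6 s e2' st' k, k < C,
      var st' (tv r 0) != 0 & True] by [].
have [e3 [st2 [k [A B [D [F1 F2 F3]]]]]] :=
  simulation (Stop := fun _ _ _ _ => True) r3 C8 HI (fun _ _ _ _ _ _ _ => I) Hrd' HqT HqF
    (exec_out Hex) (or_introl isT) (leqnn _) Hs1 (And3 erefl erefl S1).
exists e3, st2, k; split => //; first by lia.
Qed.

Lemma vbound_gt0 c : 0 < vbound c.
Proof. by elim: c => //= *; lia. Qed.

(** * Guessing the hidden instance *)

Section Chains.
Variable U : finType.
Implicit Types (X C : {set {set U}}) (R : {set U}).

Definition chain C := [forall A in C, forall B in C, (A \subset B) || (B \subset A)].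

Definition below X R := [set A in X | A \subset R].

Lemma chain_le_dim X C : C \subset X -> chain C -> #|C| <= dim X.
Proof.
by move=> CX hC; rewrite /dim (bigmax_sup C) ?CX.
Qed.

Lemma dim_chain X : exists C, [/\ C \subset X, chain C & #|C| = dim X].
Proof.
have [|C /andP [CX hC] E] := @eq_bigmax_cond _
  [pred C : {set {set U}} | (C \subset X) && chain C] (fun C => #|C|).
  apply/card_gt0P; exists set0; rewrite inE /= sub0set /=.
  by apply/forall_inP => A; rewrite inE.
by exists C; split => //; rewrite -E.
Qed.

Lemma dim_sub X X' : X \subset X' -> dim X <= dim X'.
Proof.
move=> XX'; have [C [CX hC <-]] := dim_chain X.
by apply: chain_le_dim => //; apply: subset_trans XX'.
Qed.

Lemma dim_gt0 X R : R \in X -> 0 < dim X.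
Proof.
move=> RX; rewrite -(cards1 R); apply: chain_le_dim; first by rewrite sub1set.
by apply/forall_inP => A /set1P ->; apply/forall_inP => B /set1P ->; rewrite subxx.
Qed.

(** A longest chain below [R] can be extended by [R'] itself. So the dimension of the part below a
    relation is a rank, strictly increasing along inclusion. *)
Lemma dim_below_proper X R R' :
  R' \in X -> R \proper R' -> dim (below X R) < dim (below X R').
Proof.
move=> R'X /andP [RR' nR'R]; have [C [CX hC <-]] := dim_chain (below X R).
have sR A : A \in C -> A \in X /\ A \subset R.
  by move=> /(subsetP CX); rewrite inE => /andP [].
have nC : R' \notin C by apply: contra nR'R => /sR [].
have -> : #|C|.+1 = #|R' |: C| by rewrite cardsU1 nC.
apply: chain_le_dim.
  apply/subsetP => A /setU1P [->|/sR [AX AR]]; rewrite inE ?R'X ?subxx //.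
  by rewrite AX (subset_trans AR).
apply/forall_inP => A /setU1P [->|AC]; apply/forall_inP => B /setU1P [->|BC].
- by rewrite subxx.
- by have [_ BR] := sR _ BC; rewrite (subset_trans BR RR') orbT.
- by have [_ AR] := sR _ AC; rewrite (subset_trans AR RR').
- by move/forall_inP: hC => /(_ _ AC) /forall_inP /(_ _ BC).
Qed.

End Chains.

Section Prefixes.
Variables (P : params) (n : nat).
Hypothesis n_gt0 : 0 < n.

Definition first_vars : (arity P n).-tuple 'I_(len P n) :=
  [tuple widen_ord (arity_le P n_gt0) i | i < arity P n].

Lemma first_vars_uniq : uniq first_vars.
Proof.
rewrite map_inj_uniq; first exact: enum_uniq.
by move=> i j /(congr1 val) /= E; apply: val_inj.
Qed.

(** This is where the symmetry of W enters: listing the coordinates in [J] first and the others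
    afterwards permutes [a] into an admissible assignment whose prefix is the restriction. *)
Lemma restrict_Wq (J : (arity P n).-tuple 'I_(len P n)) a :
  uniq J -> a \in adm P n -> restrict J a \in Wq P n.
Proof.
move=> uJ aW; pose rest := [seq i <- enum 'I_(len P n) | i \notin J].
have pJ : perm_eq (J ++ rest) (enum 'I_(len P n)).
  apply: uniq_perm => [| |i]; rewrite ?enum_uniq //.
    rewrite cat_uniq uJ filter_uniq ?enum_uniq // andbT; apply/hasPn => i.
    by rewrite mem_filter => /andP [].
  by rewrite mem_cat mem_filter mem_enum andbT orbN.
have sz : size (map (tnth a) rest) == len P n - arity P n.
  move/perm_size: pJ; rewrite size_cat size_tuple size_enum_ord size_map.
  by move=> E; rewrite -(addKn (arity P n) (size rest)) E.
have : perm_eq (map (tnth a) (J ++ rest)) a.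
  by rewrite -[X in perm_eq _ X]map_tnth_enum perm_map.
case/tuple_permP => p E.
rewrite inE; apply/existsP; exists (Tuple sz); apply/existsP.
exists [tuple tnth a (p i) | i < len P n]; rewrite adm_sym //= -E map_cat.
by rewrite /= -{1}(map_tnth_enum J) -map_comp.
Qed.

Lemma Wq_restrict u : u \in Wq P n ->
  exists2 a, a \in adm P n & restrict first_vars a = u.
Proof.
rewrite inE => /existsP [v /existsP [a /andP [aW /eqP E]]]; exists a => //.
apply: eq_from_tnth => i; rewrite !tnth_mktuple (tnth_nth (tnth u i)) /= E.
by rewrite nth_cat size_tuple ltn_ord -tnth_nth.
Qed.

Lemma Wq_gt0 : 0 < #|Wq P n|.
Proof.
have /set0Pn [a aW] := adm_neq0 P n_gt0.
by apply/card_gt0P; exists (restrict first_vars a); apply: restrict_Wq; rewrite ?first_vars_uniq.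
Qed.

End Prefixes.

Section Guess.
Variables (S : csp) (n m : nat).
Hypothesis n_gt0 : 0 < n.
Variables (C : instance (base_type S) n m).

Let union (K : {set 'I_(nrel S n)}) := \bigcup_(k in K) rel_of k.

(* Strictly monotone on unions, and bounded by both |W_q| and the dimension. *)
Definition weight (R : {set qtuple S n}) : nat :=
  if dim (union_rels S n) <= #|Wq S n| then dim (below (union_rels S n) R) else #|R|.

Lemma union_rel_Wq K : union K \subset Wq S n.
Proof. by apply/bigcupsP => k _; apply: rel_sub. Qed.

Lemma union_in K : union K \in union_rels S n.
Proof. exact: imset_f. Qed.

Lemma weight_le K : weight (union K) <= minn (dim (union_rels S n)) #|Wq S n|.
Proof.
rewrite /weight leq_min; case: ifP => [H|/negbT]; last rewrite -ltnNge => /ltnW H.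
  have H' : dim (below (union_rels S n) (union K)) <= dim (union_rels S n).
    by apply: dim_sub; apply/subsetP => A; rewrite inE => /andP [].
  by rewrite H' (leq_trans H' H).
have H' : #|union K| <= #|Wq S n| by apply/subset_leq_card/union_rel_Wq.
by rewrite H' (leq_trans H' H).
Qed.

Lemma weight_lt K K' : union K' \proper union K -> weight (union K') < weight (union K).
Proof.
move=> H; rewrite /weight; case: ifP => _; last exact: proper_card.
exact: dim_below_proper (union_in K) H.
Qed.

Lemma weight_mono (K K' : {set 'I_(nrel S n)}) : K' \subset K -> weight (union K') <= weight (union K).
Proof.
move=> H; have : union K' \subset union K.
  by apply/bigcupsP => k kK; apply: bigcup_sup; apply: (subsetP H).
rewrite subEproper => /predU1P [->//|/weight_lt/ltnW//].
Qed.

Definition known_scope (known : {set 'I_m}) y :=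
  if y \in known then cscope (tnth C y) else first_vars S n_gt0.

Lemma known_scope_uniq known y : uniq (known_scope known y).
Proof. by rewrite /known_scope; case: ifP; rewrite ?cscope_uniq ?first_vars_uniq. Qed.

Definition row (known : {set 'I_m}) (piv y : 'I_m) := if y \in known then y else piv.

Definition guess known (kept : {ffun 'I_m -> {set 'I_(nrel S n)}}) piv :
    instance (union_type S) n m :=
  [tuple @Constr _ (union_type S) n (kept (row known piv y)) _
    (known_scope_uniq known (row known piv y)) | y < m].

Definition guess_ok (known : {set 'I_m}) (kept : {ffun 'I_m -> {set 'I_(nrel S n)}}) piv :=
  [/\ forall y, crel (tnth C y) \in kept y,
      forall y, y \notin known -> kept y = setT &
      forall y, y \in known -> piv \in known].

(** The first summand pays for the first report of a constraint. That report need not shrink the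
    union, because the guess did not contain this constraint with its true scope. *)
Definition potential (known : {set 'I_m}) (kept : {ffun 'I_m -> {set 'I_(nrel S n)}}) :=
  \sum_y ((y \notin known) + weight (union (kept y))).

Lemma potential_le known kept :
  potential known kept <= m * (minn (dim (union_rels S n)) #|Wq S n|).+1.
Proof.
rewrite -[X in X * _]card_ord -sum_nat_const; apply: leq_sum => y _.
by rewrite -add1n leq_add ?weight_le ?leq_b1.
Qed.

Lemma sat_guess known kept piv a :
  sat (guess known kept piv) a =
  [forall y, restrict (known_scope known (row known piv y)) a
     \in union (kept (row known piv y))].
Proof. by apply: eq_forallb => y; rewrite /sat_constr tnth_mktuple. Qed.

Lemma guess_no known kept piv : guess_ok known kept piv ->
  (forall a, a \in adm S n -> ~~ sat (guess known kept piv) a) ->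
  forall a, a \in adm S n -> ~~ sat C a.
Proof.
move=> [H1 H2 H3] Hno a aW; apply/negP => aC.
have aCy y : restrict (cscope (tnth C y)) a \in rel_of (crel (tnth C y)).
  by move/forallP: aC => /(_ y).
have [E|/set0Pn [y0 /H3 pk]] := eqVneq known set0.
  (* Nothing is revealed, so every row of the guess is the union of all relations on the first q
     variables. The tuple satisfying constraint [piv] lies in W_q, hence is the beginning of an
     admissible [a'], which satisfies all rows. *)
  have := aCy piv; set k := crel _ => hk.
  have [a' a'W Ea'] := Wq_restrict n_gt0 (subsetP (rel_sub n_gt0 k) _ hk).
  have /negP := Hno a' a'W; apply; rewrite sat_guess; apply/forallP => y.
  rewrite /known_scope /row E !inE Ea' H2 ?E ?inE //.
  by apply/bigcupP; exists k; rewrite ?inE.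
have /negP := Hno a aW; apply; rewrite sat_guess; apply/forallP => y.
have rk : row known piv y \in known by rewrite /row; case: ifP.
rewrite /known_scope rk; apply/bigcupP.
by exists (crel (tnth C (row known piv y))); rewrite ?H1 ?aCy.
Qed.

Definition prune (kept : {ffun 'I_m -> {set 'I_(nrel S n)}}) j a :=
  [ffun y => if y == j
    then [set k in kept j | restrict (cscope (tnth C j)) a \notin rel_of k]
    else kept y].

Lemma guess_step known kept piv j a : guess_ok known kept piv ->
  a \in adm S n -> sat (guess known kept piv) a -> ~~ sat_constr (tnth C j) a ->
  guess_ok (j |: known) (prune kept j a) j /\
  potential (j |: known) (prune kept j a) < potential known kept.
Proof.
move=> [H1 H2 H3] aW aG aj; split.
  split=> [y|y|y _]; rewrite ?ffunE; last exact: setU11.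
    by case: eqP => [->|_] //; rewrite inE H1.
  by rewrite !inE negb_or => /andP [/negPf -> /H2].
rewrite /potential (bigD1 j) //= [X in _ < X](bigD1 j) //= -addSn; apply: leq_add; last first.
  apply: leq_sum => y yj; rewrite ffunE (negPf yj) leq_add2r !inE (negPf yj) //=.
rewrite setU11 ffunE eqxx /= add0n.
set K' := [set _ in _ | _]; have sK : K' \subset kept j by apply/subsetP => k; rewrite inE => /andP [].
have [jk|jk] := boolP (j \in known); last by rewrite add1n ltnS weight_mono.
rewrite add0n; apply: weight_lt; apply/properP; split.
  by apply/bigcupsP => k kK; apply: bigcup_sup; apply: (subsetP sK).
(* Row [j] of the guess already has the true scope, so the restriction of [a] lies in the old union;
   every relation containing it has just been removed, so it is missing from the new one. *)
move: aG; rewrite sat_guess => /forallP /(_ j); rewrite /row /known_scope jk jk => aU.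
exists (restrict (cscope (tnth C j)) a) => //.
by apply/bigcupP => - [k]; rewrite inE => /andP [_ /negP].
Qed.

End Guess.

(** * The reduction from the hidden to the union problem *)

(* Row y of the arrays [aRem] and [aScope] starts at [aBase y] = y * [vW], with
   [vW] = s + q. *)
Notation vAns := 0 (only parsing).
Notation vM := 3 (only parsing).
Notation vS := 6 (only parsing).
Notation vQ := 9 (only parsing).
Notation vL := 12 (only parsing).
Notation vW := 15 (only parsing).
Notation vPiv := 18 (only parsing).
Notation vGo := 21 (only parsing).
Notation vI := 24 (only parsing).
Notation vT := 27 (only parsing).
Notation vJ := 30 (only parsing).
Notation vK := 33 (only parsing).
Notation vB := 36 (only parsing).
Notation vU := 39 (only parsing).
Notation vG := 42 (only parsing).
Notation aBase := 3 (only parsing).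
Notation aKnown := 6 (only parsing).
Notation aRem := 9 (only parsing).
Notation aScope := 12 (only parsing).

Lemma xvE r x : xv r x = 3 * x + (24 + r).
Proof. rewrite /xv; lia. Qed.

Lemma xv_eq r x i : i < 24 + r -> (xv r x == i) = false.
Proof. rewrite xvE; lia. Qed.

Lemma nth_map_tuple (A B : Type) (f : A -> B) d m (t : m.-tuple A) (i : 'I_m) :
  nth d (map f t) i = f (tnth t i).
Proof. by rewrite (nth_map (tnth t i)) ?size_tuple // -tnth_nth. Qed.

Lemma nth_map_insub (A B : Type) (f : A -> B) d m (t : m.-tuple A) y :
  nth d (map f t) y = if insub y is Some i then f (tnth t i) else d.
Proof.
case: insubP => [i _ <-|]; first exact: nth_map_tuple.
by rewrite -leqNgt => H; rewrite nth_default // size_map size_tuple.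
Qed.

(** * Answering the reads of simulated programs *)

Definition tmp_ext (r : nat) (st st' : store) : Prop :=
  arr st' = arr st /\
  forall x, (forall i, 2 <= i < 8 -> x <> tv r i) -> var st' x = var st x.

Lemma tmp_ext_refl r st : tmp_ext r st st. Proof. by []. Qed.

Lemma tmp_ext_set r i st st' v :
  2 <= i < 8 -> tmp_ext r st st' -> tmp_ext r st (set_var st' (tv r i) v).
Proof.
move=> Hi [A B]; split=> [//|x Hx]; rewrite var_set B //.
by case: eqP => // /(Hx _ Hi).
Qed.

Lemma tmp_ext_trans r st1 st2 st3 :
  tmp_ext r st1 st2 -> tmp_ext r st2 st3 -> tmp_ext r st1 st3.
Proof. by move=> [A B] [A' B']; split=> [|x Hx]; rewrite ?A' ?B' ?B. Qed.

Ltac tmps r := repeat first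
  [ exact: tmp_ext_refl
  | apply: (@tmp_ext_set r 3 _ _ _ isT) | apply: (@tmp_ext_set r 4 _ _ _ isT)
  | apply: (@tmp_ext_set r 5 _ _ _ isT) | apply: (@tmp_ext_set r 2 _ _ _ isT) ].

(** The form of a handler for reads: it clobbers temporaries only and then assigns the target, which
    may therefore coincide with an address register. *)
Definition loads E (io : device E) e r st c x v : Prop :=
  exists2 st', tmp_ext r st st' & ev io e c st = set_var st' x v.

Lemma loads_run E (io : device E) e r N sst st c x v C :
  r < 3 -> simple c -> cost c < C -> loads io e r st c (xv r x) v ->
  sim r N sst st ->
  exists st' k, [/\ exec io c e st e st' k, k < C, same r st st' &
    sim r N (set_var sst x v) st'].
Proof.
move=> r3 Hsi Hc [st1 [Ha Hv] E1] [S1 S2 [S3 S4]].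
have [e' [s' [k [A B [? Es]]]]] : tri io c e st (cost c)
    (fun e' st' => e' = e /\ st' = set_var st1 (xv r x) v).
  by apply: tri_simple.
subst e' s'; exists (set_var st1 (xv r x) v), k; split => //.
- exact: leq_ltn_trans Hc.
- apply: same_set; first exact: xv_mod.
  split=> [y Hy|a i _]; last by rewrite Ha.
  by apply: Hv => i _ Ey; rewrite Ey tv_mod in Hy.
- apply: sim_set => //.
  have V1 : var st1 (tv r 1) = var st (tv r 1) by apply: Hv => i; rewrite /tv; lia.
  split.
  + by move=> y Hy; rewrite Hv ?S1 // => i; rewrite /tv /xv; lia.
  + by move=> a i; rewrite S2 /sget V1 Ha.
  + split; last by move=> a i; rewrite V1 Ha.
    by rewrite Hv // => i; rewrite /tv; lia.
Qed.

(* The literals 11, 14 are the temporaries [tv 2 3], [tv 2 4] and, in the programs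
   of class 1 below, 10, 13 are [tv 1 3], [tv 1 4].  Field 0 is corrected in cell
   1, since the membership problem has m = 0. *)
Definition read_member (rel tup : nat -> nat -> cmd) (x f y z : nat) : cmd :=
  match f with
  | 0 => Seq (Const 11 1) (Seq (Sub 14 y 11) (Seq (Sub 11 11 y) (Seq (Add 11 11 14)
           (If 11 (Read x 0 y y) (Const x 0)))))
  | 1 => rel x y
  | 2 => Seq (Sub 11 vQ y) (If 11 (tup x y) (Const x 0))
  | _ => Const x 0
  end.

(** Both reductions run a membership algorithm and differ only in how they fetch its name and tuple,
    hence the parameters [rel] and [tup]. The value [w] accounts for register 11, which is
    overwritten by the range test before [tup] starts. *)
Lemma read_member_spec (P : params) (F : family P) n m (r : rname F n) (u : qtuple P n)
    E (io : device E) e rel tup N x f y z sst st :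
  (forall i j, io_read io e 0 i j = param_input P n m i) ->
  var st vQ = arity P n ->
  (forall x y, [/\ simple (rel x y), cost (rel x y) <= 10, simple (tup x y) &
    cost (tup x y) <= 10]) ->
  (forall x y, y < N ->
     loads io e 2 st (rel (xv 2 x) (xv 2 y)) (xv 2 x) (rcode r (var st (xv 2 y)))) ->
  (forall x y w (i : 'I_(arity P n)), y < N -> var st (xv 2 y) = i ->
     loads io e 2 (set_var st 11 w) (tup (xv 2 x) (xv 2 y)) (xv 2 x) (tnth u i)) ->
  x < N -> y < N -> z < N -> sim 2 N sst st ->
  exists st' k,
    [/\ exec io (read_member rel tup (xv 2 x) f (xv 2 y) (xv 2 z)) e st e st' k,
        k < 20, same 2 st st' &
        sim 2 N (set_var sst x (io_read (member_device r u) tt f (var sst y) (var sst z))) st'].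
Proof.
move=> Hio HQ Hsc Hrel Htup hx hy hz Hs.
have [Hv _ _] := Hs.
have [A1 A2 A3 A4] := Hsc (xv 2 x) (xv 2 y).
have e11 : (xv 2 y == 11) = false by apply: xv_eq.
have e14 : (xv 2 y == 14) = false by apply: xv_eq.
case: f => [|[|[|f]]]; cbn [read_member].
- apply: loads_run => //; rewrite /loads /ev !var_set !eqxx /= ?updE e11 ?e14 /= Hio Hv //.
  (* The sum of the two truncated differences is the distance of the address from 1, which vanishes
     exactly at the cell holding m. *)
  case: eqP => Hy /=; last first.
    have -> : param_input P n 0 (var sst y) = param_input P n m (var sst y).
      by rewrite /param_input; case: (var sst y) Hy => [|[|k]] //=; lia.
    by eexists; last reflexivity; tmps 2.
  have -> : var sst y = 1 by lia.
  by eexists; last reflexivity; tmps 2.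
- apply: (@loads_run _ _ _ 2 N) => //=; rewrite -?Hv //; last exact: Hrel.
  exact: leq_ltn_trans A2 _.
- apply: (@loads_run _ _ _ 2 N) => //=; first by rewrite A3.
    by move: A4; lia.
  rewrite /loads /= ?updE ?eqxx HQ Hv // subn_eq0 -ltnNge.
  case: ltnP => Hy; last first.
    rewrite nth_default ?size_map ?size_tuple //.
    by eexists; last reflexivity; tmps 2.
  have [|st1 T1 ->] := Htup x y (arity P n - var sst y) (Ordinal Hy) hy; first exact: Hv.
  exists st1; last by rewrite (nth_map_tuple val 0 u (Ordinal Hy)).
  apply: tmp_ext_trans T1; tmps 2.
- by apply: loads_run => //; exists st.
Qed.

Definition row_addr (t y : nat) : cmd :=
  Seq (Get t aKnown y) (If t (Get t aBase y) (Get t aBase vPiv)).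

(** The guess is never written out: a cell is computed when it is read, so a change of pivot costs
    nothing although it changes all unrevealed rows. A scope cell 0 means that nothing is revealed
    yet and stands for the scope (0, ..., q-1), whence the answer [z]. *)
Definition read_guess (x f y z : nat) : cmd :=
  match f with
  | 0 => Read x 0 y z
  | 1 => Seq (Sub 10 vM y) (If 10 (Seq (Sub 10 vS z) (If 10
           (Seq (row_addr 10 y) (Seq (Add 10 10 z) (Seq (Get 10 aRem 10)
             (Seq (Const 13 1) (Sub x 13 10)))))
           (Const x 0))) (Const x 0))
  | 2 => Seq (Sub 10 vM y) (If 10 (Seq (Sub 10 vQ z) (If 10
           (Seq (row_addr 10 y) (Seq (Add 10 10 z) (Seq (Get 10 aScope 10)
             (If 10 (Seq (Const 13 1) (Sub x 10 13))
                    (Seq (Const 13 0) (Add x z 13))))))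
           (Const x 0))) (Const x 0))
  | _ => Const x 0
  end.

Section PartA.
Variables (S : csp) (n m : nat).
Hypothesis n_gt0 : 0 < n.
Variables (C : instance (base_type S) n m).
Local Notation W := (nrel S n + arity S n).

(* Relations are stored by their removal flags and scopes shifted by one, so that
   the initial memory already represents the initial guess. *)
Definition rep (known : {set 'I_m}) (kept : {ffun 'I_m -> {set 'I_(nrel S n)}})
    (piv : 'I_m) (st : store) : Prop :=
  [/\ var st vM = m, var st vS = nrel S n, var st vQ = arity S n,
      var st vL = len S n & var st vW = W] /\
  [/\ var st vPiv = piv,
      forall y : 'I_m, arr st aBase y = y * W,
      forall y : 'I_m, arr st aKnown y = (y \in known),
      forall (y : 'I_m) (k : 'I_(nrel S n)), arr st aRem (y * W + k) = (k \notin kept y) &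
      forall (y : 'I_m) (i : 'I_(arity S n)), arr st aScope (y * W + i) =
        if y \in known then (tnth (cscope (tnth C y)) i).+1 else 0].

Lemma rep_ext known kept piv st st' :
  (forall x, x \in [:: 3; 6; 9; 12; 15; 18] -> var st' x = var st x) ->
  (forall a i, a \in [:: 3; 6; 9; 12] -> arr st' a i = arr st a i) ->
  rep known kept piv st -> rep known kept piv st'.
Proof.
move=> Hv Ha [[A1 A2 A3 A4 A5] [B1 B2 B3 B4 B5]].
by split; split; rewrite ?Hv // => *; rewrite Ha.
Qed.

Lemma rep_set known kept piv st x v :
  x \notin [:: 3; 6; 9; 12; 15; 18] ->
  rep known kept piv st -> rep known kept piv (set_var st x v).
Proof.
by move=> Hx; apply: rep_ext => // y Hy; rewrite var_set; case: eqP => // E; rewrite -E Hy in Hx.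
Qed.

Lemma rep_same r known kept piv st st' :
  0 < r < 3 -> same r st st' -> rep known kept piv st -> rep known kept piv st'.
Proof.
move=> Hr [Hv Ha]; apply: rep_ext => [x|a i].
  by rewrite !inE => Hx; apply: Hv; lia.
by rewrite !inE => Hx; apply: Ha; lia.
Qed.

Lemma row_addr_ev known kept piv st E (io : device E) e (y : 'I_m) y' :
  rep known kept piv st -> y' != 10 -> var st y' = y ->
  ev io e (row_addr 10 y') st =
    set_var (set_var st 10 (y \in known)) 10 (row known piv y * W).
Proof.
move=> [_ [B1 B2 B3 _ _]] ne Hy; rewrite /row_addr /= updE eqxx Hy B3 /row.
by case: (y \in known) => /=; rewrite !updE ?(negPf ne) ?Hy ?B1 B2.
Qed.

Lemma read_guess_spec known kept piv E (io : device E) e N x f y z sst st :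
  (forall i j, io_read io e 0 i j = param_input S n m i) ->
  rep known kept piv st ->
  x < N -> y < N -> z < N -> sim 1 N sst st ->
  exists st' k,
    [/\ exec io (read_guess (xv 1 x) f (xv 1 y) (xv 1 z)) e st e st' k,
        k < 20, same 1 st st' &
        sim 1 N (set_var sst x (io_read (csp_device (guess n_gt0 C known kept piv)) tt f
          (var sst y) (var sst z))) st'].
Proof.
move=> Hio R hx hy hz Hs; have [Hv _ _] := Hs.
have [[A1 A2 A3 A4 A5] [B1 B2 B3 B4 B5]] := R.
have ey : (xv 1 y == 10) = false by apply: xv_eq.
have ez : (xv 1 z == 10) = false by apply: xv_eq.
have ez3 : (xv 1 z == 13) = false by apply: xv_eq.
have out_range c : var sst y >= m ->
    loads io e 1 st (Seq (Sub 10 vM (xv 1 y)) (If 10 c (Const (xv 1 x) 0))) (xv 1 x) 0.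
  move=> Hy; rewrite /loads /= updE eqxx A1 Hv // (eqP Hy).
  by eexists; last reflexivity; tmps 1.
case: f => [|[|[|f]]].
- apply: loads_run => //; exists st; rewrite //= Hio Hv //.
- cbn [io_read csp_device]; rewrite nth_map_insub; apply: loads_run => //.
  case: insubP => [i iy Ei|]; last by rewrite -leqNgt; apply: out_range.
  rewrite tnth_mktuple; have Ey : var st (xv 1 y) = i by rewrite Hv.
  have n10 : xv 1 y != 10 by rewrite ey.
  have := fun s (Rs : rep known kept piv s) => row_addr_ev io e Rs n10 (y := i).
  cbn [read_guess]; move: (row_addr _ _) => ra Hra.
  rewrite /loads /= !updE !eqxx A1 Ey subn_eq0 -ltnNge ltn_ord /= ?updE ez /= A2 Hv //.
  rewrite subn_eq0 -ltnNge; case: insubP => [k _ Ek|]; last first.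
    by rewrite -leqNgt ltnNge => ->; eexists; last reflexivity; tmps 1.
  rewrite -Ek ltn_ord Hra; first last.
  - by rewrite !var_set ey.
  - by do !apply: rep_set => //.
  rewrite /= ?updE ez ?Hv // -Ek B4.
  have -> : 1 - (k \notin kept (row known piv i)) = (k \in kept (row known piv i)).
    by case: (k \in _).
  by eexists; last reflexivity; tmps 1.
- cbn [io_read csp_device]; rewrite nth_map_insub; apply: loads_run => //.
  case: insubP => [i iy Ei|]; last by rewrite -leqNgt nth_nil; apply: out_range.
  rewrite tnth_mktuple; have Ey : var st (xv 1 y) = i by rewrite Hv.
  have n10 : xv 1 y != 10 by rewrite ey.
  have := fun s (Rs : rep known kept piv s) => row_addr_ev io e Rs n10 (y := i).
  cbn [read_guess]; move: (row_addr _ _) => ra Hra.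
  rewrite /loads /= !updE !eqxx A1 Ey subn_eq0 -ltnNge ltn_ord /= ?updE ez /= A3 Hv //.
  rewrite subn_eq0 -ltnNge (nth_map_insub val).
  case: insubP => [k _ Ek|]; last first.
    by rewrite -leqNgt ltnNge => ->; eexists; last reflexivity; tmps 1.
  rewrite -Ek ltn_ord Hra; first last.
  - by rewrite !var_set ey.
  - by do !apply: rep_set => //.
  rewrite /= ?updE ez ?ez3 ?Hv // -Ek B5 /known_scope; case: (row _ _ _ \in _) => /=.
    by rewrite ?subn1 /=; eexists; last reflexivity; tmps 1.
  rewrite ?ez ?ez3 ?Hv // -?Ek addn0 tnth_mktuple.
  by eexists; last reflexivity; tmps 1.
- by apply: loads_run => //; exists st.
Qed.

End PartA.

Section TriplesExtra.
Variables (E : Type) (io : device E).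

Lemma tri_then c1 c2 e st b b1 Q1 (Q : E -> store -> Prop) :
  tri io c1 e st b1 Q1 -> b1 <= b ->
  (forall e1 st1, Q1 e1 st1 -> tri io c2 e1 st1 (b - b1) Q) ->
  tri io (Seq c1 c2) e st b Q.
Proof.
move=> H1 Hb H2; rewrite -(subnKC Hb); apply: tri_seq.
exact: tri_weak H1 _ H2.
Qed.

Lemma tri_simple_then c1 c2 e st b (Q : E -> store -> Prop) :
  simple c1 -> cost c1 <= b -> tri io c2 e (ev io e c1 st) (b - cost c1) Q ->
  tri io (Seq c1 c2) e st b Q.
Proof.
move=> Hs Hb H2; rewrite -(subnKC Hb); apply: tri_seq.
by apply: tri_simple => //; rewrite subnKC.
Qed.

Lemma tri_query c e e' st b (Q : E -> store -> Prop) :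
  io_query io e (arr st 0) = Some e' -> 0 < b -> tri io c e' st b.-1 Q ->
  tri io (Seq Query c) e st b Q.
Proof.
move=> Hq b0 [e2 [st2 [t [A B D]]]]; exists e2, st2, (1 + t); split => //; last by lia.
by apply: ESeq A; constructor.
Qed.

Lemma tri_if_le x c1 c2 e st b (Q : E -> store -> Prop) : 0 < b ->
  (var st x != 0 -> tri io c1 e st b.-1 Q) -> (var st x = 0 -> tri io c2 e st b.-1 Q) ->
  tri io (If x c1 c2) e st b Q.
Proof. by case: b => // b _; apply: tri_if. Qed.

End TriplesExtra.

Definition chg (xs bs : seq nat) (st st' : store) : Prop :=
  (forall x, x \notin xs -> var st' x = var st x) /\
  (forall a i, a \notin bs -> arr st' a i = arr st a i).

Lemma chg_set xs bs st st' x v :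
  x \in xs -> chg xs bs st st' -> chg xs bs st (set_var st' x v).
Proof.
move=> Hx [A B]; split=> [y Hy|//]; rewrite var_set A //.
by case: eqP => // E; rewrite E Hx in Hy.
Qed.

Lemma chg_put xs bs st st' a i v :
  a \in bs -> chg xs bs st st' -> chg xs bs st (set_arr st' a i v).
Proof.
move=> Ha [A B]; split=> [//|b j Hb]; rewrite arr_set B //.
by case: eqP => // E; rewrite E Ha in Hb.
Qed.

Definition zero_class (xs : seq nat) := all (fun x => x %% 3 == 0) xs.

Lemma chg_notin xs x r : zero_class xs -> x %% 3 == r -> 0 < r -> x \notin xs.
Proof. by move=> /allP H /eqP Hx r0; apply/negP => /H; rewrite Hx; lia. Qed.

Lemma ready_chg r xs bs st st' : 0 < r < 3 ->
  zero_class xs -> zero_class bs -> chg xs bs st st' -> ready r st -> ready r st'.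
Proof.
move=> /andP [r0 r3] zx zb [A B] [H1 H2].
by split=> [|a i]; rewrite ?A ?B ?(chg_notin zx (tv_mod _ r3)) ?(chg_notin zb (sa_mod _ r3)).
Qed.

Lemma sget_chg r xs bs st st' a i : 0 < r < 3 ->
  zero_class xs -> zero_class bs -> chg xs bs st st' -> sget r st' a i = sget r st a i.
Proof.
move=> /andP [r0 r3] zx zb [A B]; rewrite /sget A ?(chg_notin zx (tv_mod _ r3)) //.
by rewrite !B ?(chg_notin zb (sa_mod _ r3)) ?(chg_notin zb (va_mod _ r3)).
Qed.

Definition copy_out (r : nat) : cmd :=
  For vG vI vL (Seq (geta r vT vU 0 vI) (Put 0 vI vU)).

Lemma copy_out_spec E (io : device E) r l e st :
  0 < r < 3 -> var st vL = l ->
  tri io (copy_out r) e st (l.+1 * 9 + 3) (fun e' st' =>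
    [/\ e' = e, chg [:: vG; vI; vT; vU] [:: 0] st st' &
        forall i, i < l -> arr st' 0 i = sget r st 0 i]).
Proof.
move=> Hr Hl.
pose I k (e' : E) st' := [/\ e' = e, chg [:: vG; vI; vT; vU] [:: 0] st st' &
  forall i, i < k -> arr st' 0 i = sget r st 0 i].
apply: tri_weak (tri_for (b := 5) (I := I) _ _ _ _ _ _ Hl _) _ _ => //.
- by move=> k e' s v [-> A B]; split => //; apply: chg_set.
- by move=> k e' s v [-> A B]; split => //; apply: chg_set.
- move=> k e' s kl Hi Hn [-> A B].
  have e1 : (tv r 1 == vT) = false by rewrite /tv; lia.
  apply: tri_simple => //; rewrite /geta /ev !var_set !eqxx e1 Hi.
  have E0 := sget_chg 0 k Hr (xs := [:: vG; vI; vT; vU]) (bs := [:: 0]) isT isT A.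
  split; [by case: ifP|by case: ifP|split => //].
    by case: ifP => _; do ![apply: chg_put => // | apply: chg_set => //].
  move=> i; rewrite ltnS leq_eqVlt => /orP [/eqP ->|ik].
    by rewrite -E0 /sget; case: eqP => _ /=; rewrite !updE /= Hi eqxx.
  have ne2 : (i == k) = false by lia.
  by rewrite -B //; case: ifP => _ /=; rewrite !updE /= Hi ne2.
- by move=> e' s [_ H].
Qed.

Definition read_params : cmd :=
  Seq (Const vT 1) (Seq (Read vM 0 vT vT)
 (Seq (Const vT 3) (Seq (Read vL 0 vT vT)
 (Seq (Const vT 4) (Seq (Read vQ 0 vT vT)
 (Seq (Const vT 5) (Seq (Read vS 0 vT vT) (Add vW vS vQ)))))))).

Lemma spellsP d l (f : nat -> nat) (a : l.-tuple 'I_d) :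
  reflect (forall i : 'I_l, f i = tnth a i :> nat) (spells f a).
Proof.
apply: (iffP eqP) => [E i|H].
  by rewrite -(nth_map_tuple val 0) -E nth_mkseq.
apply: (@eq_from_nth _ 0); first by rewrite size_mkseq size_map size_tuple.
move=> i; rewrite size_mkseq => Hi; rewrite nth_mkseq //.
by rewrite (nth_map_tuple val 0 a (Ordinal Hi)) /= -H.
Qed.

Lemma spells_inj d l (f : nat -> nat) (a b : l.-tuple 'I_d) : spells f a -> spells f b -> a = b.
Proof.
move=> /spellsP Ha /spellsP Hb; apply: eq_from_tnth => i; apply: val_inj.
by rewrite /= -Ha -Hb.
Qed.

Lemma pick_spells (P : params) n f (a : assignment P n) :
  a \in adm P n -> spells f a -> [pick b in adm P n | spells f b] = Some a.
Proof.
move=> aW Ha; case: pickP => [b /andP [_ Hb]|/(_ a)]; last by rewrite aW Ha.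
by rewrite (spells_inj Ha Hb).
Qed.

(** * The program for part (a) *)

Definition learn_scope : cmd :=
  For vG vI vQ (Seq (Read vT 2 vI vI) (Seq (Const vU 1) (Seq (Add vT vT vU)
    (Seq (Add vU vB vI) (Put aScope vU vT))))).

Definition rel_name (x y : nat) : cmd := Seq (Const 11 0) (Add x vK 11).
(** The tuple is not stored: the query still stands in array 0 and is looked up at the variables
    revealed by the latest reply. *)
Definition revealed_value (x y : nat) : cmd := Seq (Read 11 2 y y) (Get x 0 11).

Definition test_member (D : cmd) : cmd :=
  Seq (reset 2 (vbound D))
      (compile 2 (read_member rel_name revealed_value) Skip D).

Definition prune_loop (D : cmd) : cmd :=
  For vG vK vS (Seq (test_member D) (If (xv 2 0)
    (Seq (Add vU vB vK) (Seq (Const vT 1) (Put aRem vU vT))) Skip)).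

Definition learn (D : cmd) : cmd :=
  Seq (Const vJ 1) (Seq (Read vJ 1 vJ vJ) (Seq (Get vB aBase vJ)
 (Seq (Const vT 0) (Seq (Add vPiv vJ vT) (Seq (Const vT 1) (Seq (Put aKnown vJ vT)
 (Seq learn_scope (prune_loop D)))))))).

Definition attempt (A : cmd) : cmd :=
  Seq (reset 1 (vbound A)) (compile 1 read_guess Skip A).

Definition round (A D : cmd) : cmd :=
  Seq (attempt A) (If (xv 1 0)
    (Seq (copy_out 1) (Seq Query (Seq (Const vT 0) (Seq (Read vT 1 vT vT)
      (If vT (Seq (Const vAns 1) (Const vGo 0)) (learn D))))))
    (Seq (Const vAns 0) (Const vGo 0))).

(** The machine cannot multiply, so the row addresses are tabulated once by repeated addition. *)
Definition solve_hidden (A D : cmd) : cmd :=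
  Seq read_params (Seq (Const vB 0)
 (Seq (For vG vI vM (Seq (Put aBase vI vB) (Add vB vB vW)))
 (Seq (Const vGo 1) (While vGo (round A D))))).

(** * Updating the memory after a reply *)

Section PartA.
Variables (S : csp) (n m : nat).
Variables (C : instance (base_type S) n m) (O : oracle S n m).
Local Notation W := (nrel S n + arity S n).
Local Notation io := (hidden_device C O).

Lemma rep_chg known kept piv xs bs st st' :
  ~~ has (mem xs) [:: 3; 6; 9; 12; 15; 18] -> ~~ has (mem bs) [:: 3; 6; 9; 12] ->
  chg xs bs st st' -> rep C known kept piv st -> rep C known kept piv st'.
Proof.
move=> /hasPn Hx /hasPn Hb [A B]; apply: rep_ext => [x|a i] H.
  by apply: A; apply: Hx.
by apply: B; apply: Hb.
Qed.

Lemma learn_scope_spec (h : history S n m) a (j : 'I_m) st :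
  var st vQ = arity S n -> var st vB = j * W ->
  tri io learn_scope ((a, Some j) :: h) st ((arity S n).+1 * 9 + 3) (fun e' st' =>
    [/\ e' = (a, Some j) :: h, chg [:: vG; vI; vT; vU] [:: aScope] st st' &
      forall x, arr st' aScope x = if j * W <= x < j * W + arity S n
        then (nth 0 (map val (cscope (tnth C j))) (x - j * W)).+1
        else arr st aScope x]).
Proof.
move=> HQ HB; set e : history S n m := _ :: _.
pose I k (e' : history S n m) st' := [/\ e' = e, chg [:: vG; vI; vT; vU] [:: aScope] st st' &
      forall x, arr st' aScope x = if j * W <= x < j * W + k
        then (nth 0 (map val (cscope (tnth C j))) (x - j * W)).+1
        else arr st aScope x].
apply: tri_weak (tri_for (b := 5) (I := I) _ _ _ _ _ _ HQ _) _ _ => //.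
- by move=> k e' s v [-> A B]; split => //; apply: chg_set.
- by move=> k e' s v [-> A B]; split => //; apply: chg_set.
- move=> k e' s kq Hi Hn [-> A B].
  have HB' : var s vB = j * W by rewrite (proj1 A).
  apply: tri_simple => //; split => //; split => //.
    by do ![apply: chg_put => // | apply: chg_set => //].
  move=> x; rewrite /ev arr_set eqxx /= ?updE /= ?updE /= HB' Hi.
  have -> : (j * W <= x < j * W + k.+1) = ((x == j * W + k) || (j * W <= x < j * W + k)) by lia.
  by case: eqP => /= [->|_]; rewrite ?B // addKn addn1.
- by split => // x; rewrite addn0; case: ifP => //; lia.
- by move=> e' s [_ H].
Qed.

Lemma rep_learn known kept piv (j : 'I_m) st st' :
  rep C known kept piv st ->
  (forall x, x \in [:: 3; 6; 9; 12; 15] -> var st' x = var st x) -> var st' vPiv = j ->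
  (forall a i, a \in [:: 3; 9] -> arr st' a i = arr st a i) ->
  (forall y, arr st' aKnown y = if y == j then 1 else arr st aKnown y) ->
  (forall x, arr st' aScope x = if j * W <= x < j * W + arity S n
        then (nth 0 (map val (cscope (tnth C j))) (x - j * W)).+1
        else arr st aScope x) ->
  rep C (j |: known) kept j st'.
Proof.
move=> [[A1 A2 A3 A4 A5] [B1 B2 B3 B4 B5]] Hv Hp Ha Hk Hs.
split; split => //; try by rewrite Hv.
- by move=> y; rewrite Ha.
- by move=> y; rewrite Hk B3 !inE val_eqE; case: eqP.
- by move=> y k; rewrite Ha.
- move=> y i; rewrite Hs B5 !inE.
  have [->|ne] := eqVneq y j.
    rewrite leq_addr ltn_add2l ltn_ord addKn /=.
    by rewrite (nth_map_tuple val).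
  (* Rows start at multiples of [W] and only their first q cells are used for scopes, so the
     interval just written does not meet any other row. *)
  case: ifP => //= H.
  have lt1 := ltn_ord i; have : y * W + i < (y.+1) * W by rewrite mulSn; lia.
  have : y <> j :> nat by move=> /val_inj E; rewrite E eqxx in ne.
  case: (ltngtP y j) => // yj _.
    have := leq_mul yj (leqnn W); lia.
  have := leq_mul yj (leqnn W); rewrite mulSn; lia.
Qed.

(** Invariant of the pruning loop, interpolating between [kept] at [k = 0] and [prune] at
    [k = s]. *)
Definition pruned (kept : {ffun 'I_m -> {set 'I_(nrel S n)}}) j (a : assignment S n) (k : nat) :
    {ffun 'I_m -> {set 'I_(nrel S n)}} :=
  [ffun y => if y == j
    then [set i in kept j | (i < k) ==> (restrict (cscope (tnth C j)) a \notin rel_of i)]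
    else kept y].

Lemma rep_prune known kept (kept' : {ffun 'I_m -> {set 'I_(nrel S n)}}) piv
    (j : 'I_m) (k : 'I_(nrel S n)) st :
  rep C known kept piv st ->
  (forall y, kept' y = if y == j then kept j :\ k else kept y) ->
  rep C known kept' piv (set_arr st aRem (j * W + k) 1).
Proof.
move=> [[A1 A2 A3 A4 A5] [B1 B2 B3 B4 B5]] Hk.
split; split => // y i; rewrite arr_set Hk eqxx /=.
have -> : (y * W + i == j * W + k) = (y == j) && (i == k).
  have lt1 := ltn_ord i; have lt2 := ltn_ord k.
  apply/eqP/andP => [H|[/eqP -> /eqP ->]] //.
  have yj : y = j.
    apply: val_inj => /=; case: (ltngtP y j) => // yj.
      have := leq_mul yj (leqnn W); rewrite mulSn; lia.
    have := leq_mul yj (leqnn W); rewrite mulSn; lia.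
  by move: H; rewrite yj => /addnI /val_inj ->; rewrite !eqxx.
rewrite B4; case: eqP => //= ->; rewrite !inE.
by case: eqP => //=.
Qed.

Hypothesis n_gt0 : 0 < n.
Variables (D : cmd) (t : nat).
Hypothesis HD : forall (r : rname (base_type S) n) (u : qtuple S n), u \in Wq S n ->
  exists st k, [/\ exec (member_device r u) D tt store0 tt st k, k <= t &
    (var st 0 != 0) = (u \in rden r)].

Lemma test_member_spec (h : history S n m) a (j : 'I_m) (k : 'I_(nrel S n)) st :
  a \in adm S n -> spells (arr st 0) a -> var st vQ = arity S n -> var st vK = k ->
  ready 2 st ->
  tri io (test_member D) ((a, Some j) :: h) st ((vbound D).+3 + 20 * t) (fun e' st' =>
    [/\ e' = (a, Some j) :: h, same 2 st st', ready 2 st' &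
      (var st' (xv 2 0) != 0) = (restrict (cscope (tnth C j)) a \in rel_of k)]).
Proof.
move=> aW Ha HQ HK Hr; set e : history S n m := _ :: _; set u := restrict _ _.
have uW : u \in Wq S n by apply: restrict_Wq (cscope_uniq _) aW.
have [sst [t' [Hex Ht Hans]]] := @HD k u uW.
have H := @run_program _ _ (@member_device _ (base_type S) n k u) io 2 (read_member rel_name revealed_value)
   20 D tt sst t' tt e st isT isT (fun _ _ => erefl) _ Hr Hex.
apply: tri_weak (H _) _ _.
- move=> N x f y z s1 st1 hx hy hz Hs [Hv Harr].
  apply: read_member_spec hx hy hz Hs => //.
  + by rewrite Hv.
  + move=> x' y' hy'; rewrite /loads /=; eexists; last first.
      by rewrite updE /= Hv // HK addn0; reflexivity.
    by tmps 2.
  + move=> x' y' w i hy' Hy'; rewrite /loads /=; eexists; last first.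
      rewrite !updE /= xv_eq // Hy' (nth_map_tuple val) Harr //.
      move/spellsP: Ha => ->; rewrite /u tnth_mktuple; reflexivity.
    by tmps 2.
- by rewrite leq_add2l leq_mul2l Ht orbT.
- move=> e' st' [-> Hsame [Hv _ Hrd]]; split => //.
  by rewrite Hv ?vbound_gt0 // Hans.
Qed.

Lemma prune_loop_spec known kept (h : history S n m) a (j : 'I_m) st :
  a \in adm S n -> spells (arr st 0) a -> rep C known kept j st ->
  var st vB = j * W -> ready 1 st -> ready 2 st ->
  tri io (prune_loop D) ((a, Some j) :: h) st
    ((nrel S n).+1 * ((vbound D).+3 + 20 * t + 4 + 4) + 3) (fun e' st' =>
    [/\ e' = (a, Some j) :: h, rep C known (prune C kept j a) j st', ready 1 st',
      ready 2 st' & var st' vGo = var st vGo]).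
Proof.
move=> aW Ha R HB R1 R2; set e : history S n m := _ :: _.
pose I k (e' : history S n m) s := [/\ e' = e, rep C known (pruned kept j a k) j s,
  ready 1 s /\ ready 2 s, var s vB = j * W /\ var s vGo = var st vGo & spells (arr s 0) a].
have Iset x k e' s v : x \in [:: vG; vK] -> I k e' s -> I k e' (set_var s x v).
  move=> Hx [-> A [B1 B2] [D1 D2] F].
  have G : chg [:: vG; vK] [::] s (set_var s x v) by apply: chg_set.
  split => //; [exact: rep_chg G A|split; exact: ready_chg G _|].
  by rewrite !(proj1 G).
have HS : var st vS = nrel S n by case: R => [[]].
apply: tri_weak (tri_for (I := I) (b := (vbound D).+3 + 20 * t + 4) _ _ _ _ _ _ HS _) _ _ => //.
- move=> k e' s ks Hk Hn [-> A [B1 B2] [D1 D2] F].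
  have HQ : var s vQ = arity S n by case: A => [[]].
  apply: tri_then (test_member_spec h j (k := Ordinal ks) aW F HQ Hk B2) _ _ => //.
    exact: leq_addr.
  move=> e1 s1 [-> Hsame Hr2 Hans]; rewrite addKn.
  have A1 : rep C known (pruned kept j a k) j s1 by apply: rep_same Hsame A.
  have Hr1 : ready 1 s1 by apply: ready_same Hsame B1.
  have [Hv Harr] := Hsame.
  have F1 : spells (arr s1 0) a by apply/spellsP => i; rewrite Harr //; apply/spellsP.
  have st1 : var s1 vB = j * W /\ var s1 vGo = var st vGo by rewrite !Hv.
  have HK1 : var s1 vK = k by rewrite Hv.
  have HS1 : var s1 vS = nrel S n by rewrite Hv.
  apply: tri_if_le => // Hx; apply: tri_simple => //.
    have Hin : restrict (cscope (tnth C j)) a \in rel_of (Ordinal ks) by rewrite -Hans.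
    pose s2 := set_var (set_var s1 vU (j * W + k)) vT 1.
    have -> : ev io e (Seq (Add vU vB vK) (Seq (Const vT 1) (Put aRem vU vT))) s1 =
        set_arr s2 aRem (j * W + Ordinal ks) 1.
      by rewrite /s2 /= st1.1 HK1.
    have G : chg [:: vU; vT] [:: aRem] s1 (set_arr s2 aRem (j * W + Ordinal ks) 1).
      by apply: chg_put => //; do !apply: chg_set => //.
    split; [by rewrite (proj1 G)|by rewrite (proj1 G)|split => //].
    + apply: rep_prune (_ : rep C known (pruned kept j a k) j s2) _.
        by do 2!apply: rep_set => //.
      move=> y; rewrite !ffunE eqxx; case: eqP => // _.
      apply/setP => i; rewrite !inE ltnS leq_eqVlt.
      have [->|ne] := eqVneq i (Ordinal ks).
        by rewrite eqxx /= Hin andbF.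
      by have -> : (i == k :> nat) = false by apply/eqP => E; case/eqP: ne; apply: val_inj.
    + by split; apply: ready_chg G _.
  split => //; split => //.
  suff <- : pruned kept j a k = pruned kept j a k.+1 by [].
  apply/ffunP => y; rewrite !ffunE; case: eqP => // _.
  apply/setP => i; rewrite !inE [i < k.+1]ltnS [i <= k]leq_eqVlt.
  have [->|ne] := eqVneq i (Ordinal ks).
    by rewrite eqxx ltnn /= -Hans Hx.
  by have -> : (i == k :> nat) = false by apply/eqP => E; case/eqP: ne; apply: val_inj.
- split => //.
  suff -> : pruned kept j a 0 = kept by [].
  apply/ffunP => y; rewrite !ffunE; case: eqP => // ->.
  by apply/setP => i; rewrite !inE andbT.
- move=> e' s [_ [-> A [B1 B2] [D1 D2] _]]; split => //.
  suff <- : pruned kept j a (nrel S n) = prune C kept j a by [].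
  apply/ffunP => y; rewrite !ffunE; case: eqP => // _.
  by apply/setP => i; rewrite !inE ltn_ord.
Qed.

End PartA.

(** * The search of part (a) and its cost *)

Section PartA.
Variables (S : csp) (n m : nat).
Hypothesis n_gt0 : 0 < n.
Variables (C : instance (base_type S) n m) (O : oracle S n m).
Hypothesis OC : valid_oracle C O.
Local Notation W := (nrel S n + arity S n).
Local Notation io := (hidden_device C O).
Variables (A D : cmd) (T t : nat).
Hypothesis HD : forall (r : rname (base_type S) n) (u : qtuple S n), u \in Wq S n ->
  exists st k, [/\ exec (member_device r u) D tt store0 tt st k, k <= t &
    (var st 0 != 0) = (u \in rden r)].
Hypothesis HA : forall G : instance (union_type S) n m, exists st k,
  [/\ exec (csp_device G) A tt store0 tt st k, k + output_steps S n st <= T &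
      correct_answer G st].

Definition learn_bound := (arity S n).+1 * 9 + 3 +
  ((nrel S n).+1 * ((vbound D).+3 + 20 * t + 4 + 4) + 3) + 7.

Lemma learn_spec known kept piv (h : history S n m) a (j : 'I_m) st :
  a \in adm S n -> spells (arr st 0) a -> rep C known kept piv st ->
  ready 1 st -> ready 2 st ->
  tri io (learn D) ((a, Some j) :: h) st learn_bound (fun e' st' =>
    [/\ rep C (j |: known) (prune C kept j a) j st', ready 1 st',
      ready 2 st' & var st' vGo = var st vGo]).
Proof.
move=> aW Ha R R1 R2; rewrite /learn_bound.
have [[A1 A2 A3 A4 A5] [B1 B2 B3 B4 B5]] := R.
set pre := Seq (Const vJ 1) (Seq (Read vJ 1 vJ vJ) (Seq (Get vB aBase vJ)
  (Seq (Const vT 0) (Seq (Add vPiv vJ vT) (Seq (Const vT 1) (Put aKnown vJ vT)))))).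
set b := _ + 7.
pose st1 := ev io ((a, Some j) :: h) pre st.
have G1 : chg [:: vJ; vB; vT; vPiv] [:: aKnown] st st1.
  by rewrite /st1 /pre /ev; do ![apply: chg_put => // | apply: chg_set => //].
have J1 : var st1 vPiv = j by rewrite /st1 /= /upd /= addn0.
have J2 : var st1 vB = j * W by rewrite /st1 /= /upd /= B2.
have J3 y : arr st1 aKnown y = if y == j then 1 else arr st aKnown y.
  by rewrite /st1 /= /upd /=.
have Q1 : var st1 vQ = arity S n by rewrite (proj1 G1).
have Rd r : 0 < r < 3 -> ready r st -> ready r st1 by move=> Hr; apply: ready_chg G1.
have loops : tri io (Seq learn_scope (prune_loop D)) ((a, Some j) :: h) st1 (b - 7)
    (fun e' st' => [/\ rep C (j |: known) (prune C kept j a) j st', ready 1 st',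
      ready 2 st' & var st' vGo = var st vGo]).
  have bound : (arity S n).+1 * 9 + 3 <= b - 7 by rewrite /b; lia.
  apply: (tri_then (learn_scope_spec C O h a Q1 J2) bound) => e2 st2 [-> G2 Hsc].
  have Rd2 r : 0 < r < 3 -> ready r st -> ready r st2.
    by move=> Hr /(Rd _ Hr); apply: ready_chg G2.
  have R' : rep C (j |: known) kept j st2.
    apply: (rep_learn R).
    - move=> x Hx; rewrite (proj1 G2) ?(proj1 G1) //; move: Hx; rewrite !inE; lia.
    - by rewrite (proj1 G2).
    - move=> c i Hc; rewrite (proj2 G2) ?(proj2 G1) //; move: Hc; rewrite !inE; lia.
    - by move=> y; rewrite (proj2 G2).
    - by move=> x; rewrite Hsc (proj2 G1).
  have HB2 : var st2 vB = j * W by rewrite (proj1 G2).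
  have F2 : spells (arr st2 0) a.
    by apply/spellsP => i; rewrite (proj2 G2) // (proj2 G1) //; apply/spellsP.
  apply: tri_weak (prune_loop_spec O n_gt0 HD h aW F2 R' HB2 (Rd2 1 isT R1) (Rd2 2 isT R2)) _ _.
    by rewrite /b; lia.
  move=> e3 st3 [_ X1 X2 X3 X4]; split => //.
  by rewrite X4 (proj1 G2) // (proj1 G1).
have b7 : 7 <= b by rewrite /b; lia.
rewrite /learn; do 7!(apply: tri_simple_then; [by []|by rewrite /=; lia|]).
by apply: tri_weak loops _ _ => //; rewrite /b /=; lia.
Qed.

(** The two terms [T.+1 * 9 + 3] bound the copying of the assignment and of the revealed scope. They
    arise only if the union algorithm has output an assignment, and then q and l are at most [T]. *)
Definition round_bound := (vbound A).+3 + 20 * T + (T.+1 * 9 + 3) + 20 +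
  (T.+1 * 9 + 3 + ((nrel S n).+1 * ((vbound D).+3 + 20 * t + 4 + 4) + 3) + 7).

Definition searching mu (h : history S n m) (st : store) : Prop :=
  exists known kept piv, [/\ guess_ok C known kept piv, rep C known kept piv st,
    ready 1 st /\ ready 2 st, var st vGo = 1 & mu = potential known kept].

Definition finished (h : history S n m) (st : store) : Prop :=
  correct_answer C st /\ output_steps S n st <= T.

Lemma round_spec mu h st : searching mu h st ->
  tri io (round A D) h st round_bound (fun h' st' =>
    var st' vGo = 0 /\ finished h' st' \/
    exists2 mu', mu' < mu & searching mu' h' st').
Proof.
move=> [known [kept [piv [ok R [R1 R2] go ->]]]].
pose G := guess n_gt0 C known kept piv.
have [sst [k [Hex Hk Hans]]] := HA G.
have HqA e f : io_query (csp_device G) e f = None by [].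
have hrd N x f y z s1 s (hx : x < N) (hy : y < N) (hz : z < N) (Hs : sim 1 N s1 s)
    (Hsame : same 1 st s) :
    exists st' k, [/\ exec io (read_guess (xv 1 x) f (xv 1 y) (xv 1 z)) h s h st' k,
      k < 20, same 1 s st' &
      sim 1 N (set_var s1 x (io_read (csp_device G) tt f (var s1 y) (var s1 z))) st'].
  by apply: read_guess_spec => //; apply: rep_same Hsame R.
have runA := run_program (isT : 1 < 3) (isT : 8 <= 20) HqA hrd R1 Hex.
rewrite /round /attempt.
have bA : (vbound A).+3 + 20 * k <= round_bound by rewrite /round_bound; lia.
apply: (tri_then runA bA) => _ st1 [-> Hsame Hsim].
have [Hv Ha Hrd1] := Hsim; have V0 : var st1 (xv 1 0) = var sst 0 by rewrite Hv ?vbound_gt0.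
have Rep1 : rep C known kept piv st1 by apply: rep_same Hsame R.
have Hr2 : ready 2 st1 by apply: ready_same Hsame R2.
apply: tri_if_le => [|Hnz|Hz]; first by rewrite /round_bound; lia.
  move: Hans; rewrite /correct_answer -V0 (negPf Hnz) => - [a [aW aG Hsp]].
  move: Hk; rewrite /output_steps -V0 (negPf Hnz) => Hk.
  have lT : len S n <= T by lia.
  have HL : var st1 vL = len S n by case: Rep1 => [[]].
  have bC : (len S n).+1 * 9 + 3 <= (round_bound - ((vbound A).+3 + 20 * k)).-1.
    by rewrite /round_bound; lia.
  apply: (tri_then (copy_out_spec io h (isT : 0 < 1 < 3) HL) bC) => _ st2 [-> G2 Hc].
  have F2 : spells (arr st2 0) a.
    by apply/spellsP => i; rewrite Hc // -Ha; move: i; apply/spellsP.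
  have Hq : io_query io h (arr st2 0) = Some ((a, O h a) :: h).
    by rewrite /= (pick_spells aW F2).
  have Rep2 : rep C known kept piv st2 by apply: rep_chg G2 Rep1.
  have Rd1 : ready 1 st2 by apply: ready_chg G2 Hrd1.
  have Rd2 : ready 2 st2 by apply: ready_chg G2 Hr2.
  have go2 : var st2 vGo = 1 by rewrite (proj1 G2) // (proj1 Hsame).
  apply: tri_query Hq _ _; first by rewrite /round_bound; lia.
  do 2!(apply: tri_simple_then => //; first by rewrite /round_bound /=; lia).
  set st3 := ev _ _ _ _.
  have G3 : chg [:: vT] [::] st2 st3.
    by rewrite /st3 /ev; do !apply: chg_set => //.
  apply: tri_if_le; first by rewrite /round_bound /=; lia.
    move=> yes; apply: tri_simple => //; first by rewrite /round_bound /=; lia.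
    have Oh : O h a = None.
      by move: yes; rewrite /st3 /= /upd /=; case: (O h a).
    left; split => //; split; last by [].
    rewrite /correct_answer /=; exists a; split => //.
    by have := OC h aW; rewrite Oh.
  move=> no; case Oh: (O h a) => [j|]; last by move: no; rewrite /st3 /= /upd /= Oh.
  have [R3a R3b R3c R3d] : [/\ rep C known kept piv st3, ready 1 st3, ready 2 st3 &
      spells (arr st3 0) a].
    split; [exact: rep_chg G3 Rep2|exact: ready_chg G3 Rd1|exact: ready_chg G3 Rd2|by []].
  apply: tri_weak (learn_spec (piv := piv) h j aW R3d R3a R3b R3c) _ _.
    have qT : arity S n <= T by apply: leq_trans lT; apply: arity_le.
    by rewrite /round_bound /learn_bound /=; lia.
  move=> h' st4 [X1 X2 X3 X4]; right.
  have viol : ~~ sat_constr (tnth C j) a by have := OC h aW; rewrite Oh.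
  have [ok' lt] := guess_step ok aW aG viol.
  exists (potential (j |: known) (prune C kept j a)) => //.
  exists (j |: known), (prune C kept j a), j; split => //.
  by rewrite X4 (proj1 G3).
apply: tri_simple => //; first by rewrite /round_bound /=; lia.
left; split => //; split => //.
rewrite /correct_answer /=; apply: guess_no ok _.
by move: Hans; rewrite /correct_answer -V0 Hz.
Qed.

Lemma solve_hidden_spec : 0 < m ->
  tri io (solve_hidden A D) [::] store0
    (9 + (1 + ((m.+1 * 6 + 3) + (1 +
      ((m * (minn (dim (union_rels S n)) #|Wq S n|).+1).+1 * (round_bound + 1) + 1))))) finished.
Proof.
move=> m0; rewrite /solve_hidden; apply: tri_seq; apply: tri_simple => //.
set st1 := ev _ _ _ _.
have P1 : [/\ var st1 vM = m, var st1 vS = nrel S n, var st1 vQ = arity S n,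
      var st1 vL = len S n & var st1 vW = W] by [].
have Z1 : (forall x, x \notin [:: vT; vM; vL; vQ; vS; vW] -> var st1 x = 0) /\
    (forall a i, arr st1 a i = 0).
  have G : chg [:: vT; vM; vL; vQ; vS; vW] [::] store0 st1.
    by rewrite /st1 /ev; do !apply: chg_set => //.
  by split=> [x Hx|a i]; rewrite ?(proj1 G) ?(proj2 G).
move: st1 P1 Z1 => st1 [A1 A2 A3 A4 A5] [Zv Za].
apply: tri_seq; apply: tri_simple => //; set st2 := ev _ _ _ _.
pose I k (h : history S n m) st := [/\ h = [::],
  chg [:: vG; vI; vB] [:: aBase] st1 st, var st vB = k * W &
  forall y, y < k -> arr st aBase y = y * W].
apply: tri_seq.
apply: tri_weak (tri_for (I := I) (N := m) (b := 2) _ _ _ _ _ _ _ _) (leqnn _) _ => //.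
- by move=> k h s v [-> B1 B2 B3]; split => //; apply: chg_set.
- by move=> k h s v [-> B1 B2 B3]; split => //; apply: chg_set.
- move=> k h s km Hi Hn [-> B1 B2 B3]; apply: tri_simple => //; split => //; split => //.
  + by rewrite /ev; apply: chg_set => //; apply: chg_put.
  + by rewrite /= /upd /= B2 (proj1 B1) // A5 mulSn addnC.
  + move=> y; rewrite ltnS leq_eqVlt => /predU1P [->|yk].
      by rewrite /= /upd /= Hi B2 eqxx.
    by rewrite /= /upd /= Hi B3 //; case: eqP => // E; lia.
- split => //; apply: chg_set => //.
move=> _ st3 [Hn [-> B1 B2 B3]]; apply: tri_seq; apply: tri_simple => //.
set st4 := ev _ _ _ _.
have G4 : chg [:: vG; vI; vB; vGo] [:: aBase] st1 st4.
  apply: chg_set => //; case: B1 => [B1 B1']; split => // x Hx; apply: B1.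
  by apply: contra Hx; rewrite !inE => /or3P [] ->; rewrite ?orbT.
(* The arrays for known rows, removals and scopes are still zero, which encodes that nothing is
   known and nothing removed; pivot 0 is the value that its register already holds. *)
pose piv0 := Ordinal m0.
pose kept0 : {ffun 'I_m -> {set 'I_(nrel S n)}} := [ffun=> setT].
have S4 : searching (potential set0 kept0) [::] st4.
  exists set0, kept0, piv0; split => //.
  - by split=> y; rewrite ?ffunE ?inE.
  - split; split => //; try by rewrite (proj1 G4).
    + by rewrite (proj1 G4) // Zv.
    + by move=> y; apply: B3.
    + by move=> y; rewrite (proj2 G4) // Za inE.
    + by move=> y k; rewrite (proj2 G4) // Za ffunE inE.
    + by move=> y i; rewrite (proj2 G4) // Za inE.
  - have Hrd r : 0 < r < 3 -> ready r st4.
      move=> Hr; apply: (ready_chg Hr _ _ G4) => //.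
      split=> [|a i]; last by rewrite Za.
      by apply: Zv; rewrite !inE /tv; lia.
    by split; apply: Hrd.
apply: tri_weak (@tri_while _ io vGo (round A D) round_bound searching finished
  (potential set0 kept0) [::] st4 _ _ S4) _ _ => //.
- by move=> mu h s Hs _; apply: round_spec.
- by move=> mu h s [? [? [? [_ _ _ go _]]]]; rewrite go.
- by rewrite leq_add2r leq_mul // ltnS potential_le.
Qed.

End PartA.

(** All parameters being positive, each additive term is absorbed by the product; the constant
    depends only on the two programs. *)
Lemma total_bound (vA vD t s c m M : nat) :
  0 < t -> 0 < s -> 0 < c -> 0 < m -> 0 < M ->
  9 + (1 + ((m.+1 * 6 + 3) + (1 + ((m * M.+1).+1 *
    ((vA.+3 + 20 * t + (t.+1 * 9 + 3) + 20 +
      (t.+1 * 9 + 3 + (s.+1 * (vD.+3 + 20 * c + 4 + 4) + 3) + 7)) + 1) + 1)))) + t <=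
  1000 * (vA.+1 + vD.+1) * ((t + s * c) * m * M).
Proof.
move=> t1 s1 c1 m1 M1; pose K := vA + 2 * vD + 158.
have [p Ep] : exists p, p = s * c by exists (s * c).
have sp : s <= p by rewrite Ep leq_pmulr.
have cp : c <= p by rewrite Ep leq_pmull.
have vp : s * vD <= p * vD by rewrite leq_mul.
have p1 : 0 < p by rewrite Ep muln_gt0 s1.
have HK : vA.+3 + 20 * t + (t.+1 * 9 + 3) + 20 +
    (t.+1 * 9 + 3 + (s.+1 * (vD.+3 + 20 * c + 4 + 4) + 3) + 7) + 1 <= K * (t + p).
  have -> : s.+1 * (vD.+3 + 20 * c + 4 + 4) = vD + 20 * c + 11 + (s * vD + 20 * p + 11 * s).
    by rewrite Ep; lia.
  have h1 : vA <= vA * (t + p) by rewrite leq_pmulr // addn_gt0 t1.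
  have h2 : vD <= vD * p by rewrite leq_pmulr.
  rewrite /K; nia.
set rb := _ + 1 in HK *.
have mM : m <= m * M by rewrite leq_pmulr.
have Y1 : 0 < m * M by rewrite muln_gt0 m1.
rewrite -Ep -(mulnA (t + p)); set X := t + p in HK *; set Y := m * M in mM Y1 *.
have tX : t <= X by apply: leq_addr.
have hY : (m * M.+1).+1 <= 3 * Y by rewrite mulnS -/Y; lia.
have XY1 : X <= X * Y by rewrite leq_pmulr.
have XY2 : Y <= X * Y by rewrite leq_pmull //; lia.
have := leq_mul hY HK.
have -> : 3 * Y * (K * X) = 3 * K * (X * Y) by rewrite !mulnA; lia.
have : (28 + 3 * K) * (X * Y) <= 1000 * (vA.+1 + vD.+1) * (X * Y).
  by rewrite leq_mul2r; apply/orP; right; rewrite /K; lia.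
lia.
Qed.

Lemma part_a (S : csp) (T : nat -> nat -> nat) (compR : nat -> nat) :
  csp_in_time (union_type S) T -> member_in_time (base_type S) compR ->
  hidden_in_O (base_type S) (fun n m =>
    (T n m + nrel S n * compR n) * m * minn (dim (union_rels S n)) #|Wq S n|).
Proof.
move=> [A HA] [D HD].
exists (1000 * ((vbound A).+1 + (vbound D).+1)), (solve_hidden A D).
move=> n m n0 m0 C O OC.
have [h [st [k [Hex Hk [Hans Hout]]]]] :=
  solve_hidden_spec n0 OC (HD n n0) (HA n m n0 m0) m0.
exists h, st, k; split => //.
apply: leq_trans (leq_add Hk Hout) _.
(* Every run takes at least one step, so [T] is positive as soon as an instance exists; the initial
   guess provides one. *)
have T1 : 0 < T n m.
  have G : instance (union_type S) n m.
    exact: (guess n0 C set0 [ffun=> setT] (Ordinal m0)).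
  have [s [k' [Hex' Hk' _]]] := HA n m n0 m0 G.
  by have := exec_gt0 Hex'; lia.
have s1 := nrel_gt0 S n0.
have c1 : 0 < compR n.
  have /card_gt0P [u uW] := Wq_gt0 S n0.
  have [s [k' [Hex' Hk' _]]] := HD n n0 (Ordinal s1) u uW.
  by have := exec_gt0 Hex'; lia.
set M := minn _ _.
(* The empty union is a relation of the type, so already a one-element chain exists. *)
have M1 : 0 < M.
  rewrite /M leq_min Wq_gt0 // andbT.
  by apply: (dim_gt0 (R := \bigcup_(k in set0) rel_of k)); apply: imset_f.
rewrite /round_bound.
move: {HA HD Hex Hk Hans Hout} (T n m) (nrel S n) (compR n) (vbound A) (vbound D) T1 s1 c1.
move=> t s c vA vD t1 s1 c1; exact: total_bound.
Qed.

(** * The reduction from the union to the hidden problem *)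

Lemma out_size E (io : device E) (f : E -> nat) c e st b e' st' t :
  (forall e g e', io_query io e g = Some e' -> f e' <= (f e).+1) ->
  out io c e st b e' st' t -> f e' <= f e + t.
Proof. by move=> Hq; elim=> *; try lia; rewrite addn1; eauto. Qed.

Lemma card_cover_le (X : finType) (Y : eqType) (G : {set X}) (hit : Y -> {set X}) (s : seq Y) t :
  (forall y, y \in s -> #|hit y| <= t) ->
  (forall x, x \in G -> has (fun y => x \in hit y) s) -> #|G| <= size s * t.
Proof.
elim: s G => [|y s IH] G Ht HG /=.
  suff -> : G = set0 by rewrite cards0.
  by apply/setP => x; rewrite inE; apply/negP => /HG.
rewrite mulSn -(cardsID (hit y) G); apply: leq_add.
  by apply: leq_trans (Ht y (mem_head _ _)); apply/subset_leq_card/subsetIr.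
apply: IH => [z zs|x]; first by apply: Ht; rewrite inE zs orbT.
by rewrite inE => /andP [/negPf nx /HG /=]; rewrite nx.
Qed.

(** * Bounding the number of relations *)

Section LowerBound.
Variables (S : csp) (n m : nat).
Hypothesis n_gt0 : 0 < n.

Section Names.
Variables (D : cmd) (t : nat).
Hypothesis HD : forall (r : rname (union_type S) n) (u : qtuple S n), u \in Wq S n ->
  exists st k, [/\ exec (member_device r u) D tt store0 tt st k, k <= t &
    (var st 0 != 0) = (u \in rden r)].

(* Started on the name of the empty union, [D] must look at the bit of every
   relation containing [u], since adding that relation changes the answer. *)
Lemma card_containing u : u \in Wq S n ->
  #|[set k : 'I_(nrel S n) | u \in rel_of k]| <= t.
Proof.
move=> uW; have [st [t0 [Hex Ht Hans]]] := HD set0 uW.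
have [L sL HL] := exec_reads Hex.
apply: leq_trans (leq_trans sL Ht).
rewrite cardE -(size_map val (enum _)); apply: uniq_leq_size.
  by rewrite map_inj_uniq ?enum_uniq //; apply: val_inj.
move=> y /mapP [k]; rewrite mem_enum inE => uk ->; apply/negPn/negP => kL.
have [st' [t' [Hex' _ Hans']]] := HD [set k] uW.
have Hex2 : exec (@member_device _ (union_type S) n [set k] u) D tt store0 tt st t0.
  apply: HL => // e f i z; case: f => [|[|f]] //=; move=> iL.
  case: insubP => // i' _ ii; rewrite !inE.
  by case: eqP => // E; rewrite -ii E (negPf kL) in iL.
have [_ Est _] := exec_det Hex2 Hex'.
move: Hans' Hans; rewrite -Est => -> /= /esym.
by rewrite big_set0 big_set1 inE uk.
Qed.

End Names.

Hypothesis m_gt0 : 0 < m.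
Let J := first_vars S n_gt0.
Let j0 : 'I_m := Ordinal m_gt0.

Definition constant_instance k : instance (base_type S) n m :=
  [tuple @Constr _ (base_type S) n k J (first_vars_uniq S n_gt0) | _ < m].

Definition miss k (a : assignment S n) := restrict J a \notin rel_of k.

Definition constant_oracle k : oracle S n m :=
  fun h a => if miss k a then Some j0 else None.

Lemma constant_oracle_valid k : valid_oracle (constant_instance k) (constant_oracle k).
Proof.
move=> h a aW; rewrite /constant_oracle; case: ifPn => H.
  by rewrite /sat_constr tnth_mktuple.
by apply/forallP => j; rewrite /sat_constr tnth_mktuple; rewrite negbK in H.
Qed.

(** Every legal query is answered by constraint [j0] with scope [J], whatever the relation. Only the
    set of legal queries depends on it, so runs for different relations can be compared through
    common restrictions. *)
Definition probe (legal : assignment S n -> bool) : device (history S n m) :=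
  Device (fun h f y _ =>
      match f with
      | 0 => param_input S n m y
      | 1 => match last_reply h with
             | None => 0
             | Some None => nth 0 [:: 1] y
             | Some (Some j) => nth 0 [:: 0; val j] y
             end
      | 2 => if last_reply h is Some (Some j) then nth 0 (map val J) y else 0
      | _ => 0
      end)
    (fun h f => if [pick a in adm S n | spells f a] is Some a
      then if legal a then Some ((a, Some j0) :: h) else None else None).

Lemma probe_sub (P Q : assignment S n -> bool) :
  (forall a, P a -> Q a) -> subdevice (probe P) (probe Q).
Proof.
move=> PQ; split=> // h f h' /=; case: pickP => // a _.
by case: ifP => // /PQ ->.
Qed.

Lemma probe_hidden k :
  subdevice (probe (miss k)) (hidden_device (constant_instance k) (constant_oracle k)).
Proof.
split=> [h [|[|[|f]]] y z|h f h'] //=.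
  by case: last_reply => // - [j|] //; rewrite tnth_mktuple.
by case: pickP => // a _; rewrite /constant_oracle; case: ifP.
Qed.

Definition suffix_of (h h' : history S n m) := exists l, h' = l ++ h.

Lemma suffix_of_refl h : suffix_of h h. Proof. by exists [::]. Qed.

Lemma suffix_of_trans h1 h2 h3 : suffix_of h1 h2 -> suffix_of h2 h3 -> suffix_of h1 h3.
Proof. by move=> [l ->] [l' ->]; exists (l' ++ l); rewrite catA. Qed.

Lemma suffix_probe P h f h' : io_query (probe P) h f = Some h' -> suffix_of h h'.
Proof.
by rewrite /=; case: pickP => // a _; case: ifP => // _ [<-]; exists [:: (a, Some j0)].
Qed.

Lemma suffix_hidden k h f h' :
  io_query (hidden_device (constant_instance k) (constant_oracle k)) h f = Some h' ->
  suffix_of h h'.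
Proof.
rewrite /=; case: pickP => // a _ [<-]; by exists [:: (a, constant_oracle k h a)].
Qed.

Variables (B : cmd) (T : nat).
Hypothesis HB : forall (C : instance (base_type S) n m) (O : oracle S n m),
  valid_oracle C O -> exists h st k,
    [/\ exec (hidden_device C O) B [::] store0 h st k,
        k + output_steps S n st <= T & correct_answer C st].

(** A nonempty relation makes the constant instance satisfiable, so the algorithm may not answer no.
    Either it outputs a solution or it is stopped at a query whose restriction lies in the relation;
    in both cases the assignment stands in array 0. *)
Lemma probe_run k : rel_of k != set0 -> exists b h st,
  [/\ exists2 t, t <= T & out (probe (miss k)) B [::] store0 b h st t &
      exists a, [/\ a \in adm S n, spells (arr st 0) a & restrict J a \in rel_of k]].
Proof.
move=> /set0Pn [u uk].
have [h [st [t [Hex Ht Hans]]]] := HB (@constant_oracle_valid k).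
have tT : t <= T by lia.
have [Ho|[h1 [h2 [st1 [t1 [Ho Ht1 Hq _]]]]]] := out_sub (probe_hidden k)
    suffix_of_refl suffix_of_trans (@suffix_hidden k) (exec_out Hex).
  exists true, h, st; split; first by exists t.
  move: Hans; rewrite /correct_answer; case: ifP => _ Hans; last first.
    have [a [aW aC Ha]] := Hans; exists a; split => //.
    by move/forallP: aC => /(_ j0); rewrite /sat_constr tnth_mktuple.
  have [a aW Ea] := Wq_restrict n_gt0 (subsetP (rel_sub n_gt0 k) _ uk).
  have /negP := Hans a aW; case; apply/forallP => j.
  by rewrite /sat_constr tnth_mktuple /= Ea.
exists false, h1, st1; split; first by exists t1 => //; apply: leq_trans tT.
have := out_blocked Ho; move: Hq; rewrite /=; case: pickP => // a /andP [aW Ha] _.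
by rewrite /miss; case: ifPn => //; rewrite negbK => ak _; exists a.
Qed.

(* The run against the relation that is hit last hits all of them. *)
Lemma hitting_set : exists2 s : seq (assignment S n), size s <= T.+1 &
  {subset s <= adm S n} /\
  forall k, rel_of k != set0 -> has (fun a => restrict J a \in rel_of k) s.
Proof.
have [K0|/set0Pn [k0]] := eqVneq [set k : 'I_(nrel S n) | rel_of k != set0] set0.
  exists [::] => //; split => // k Hk.
  by move/setP: K0 => /(_ k); rewrite !inE Hk.
rewrite inE => Hk0.
pose good k len := rel_of k != set0 /\ exists b h st,
  [/\ exists2 t, t <= T & out (probe (miss k)) B [::] store0 b h st t &
      exists a, [/\ a \in adm S n, spells (arr st 0) a & restrict J a \in rel_of k]]
  /\ size h = len.
have hsize P b h st t : out (probe P) B [::] store0 b h st t -> size h <= t.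
  move=> /(@out_size _ _ size); apply => e g e' /=.
  by case: pickP => // a _; case: ifP => // _ [<-].
have [k1 [l [[Hk1 [b1 [h1 [st1 [[[t1 Ht1 Ho1] [a1 [a1W Ha1 ak1]]] Hl]]]]] Hmax]]] :
    exists k l, good k l /\ forall k' l', good k' l' -> l' <= l.
  (* Histories have length at most [T], so a longest one is found by climbing. [good] is an
     existential statement about runs, hence the excluded middle. *)
  have step N : N <= T.+1 -> (exists k l, good k l /\ T.+1 - N <= l) ->
      exists k l, good k l /\ forall k' l', good k' l' -> l' <= l.
    elim: N => [|N IH] NT [k [l [g Hl]]].
      case: (g) => _ [b [h [st [[[t Ht Ho] _] E]]]].
      by have := hsize _ _ _ _ _ Ho; lia.
    have [[k' [l' [g' Hl']]]|no] := classic
        (exists k l, good k l /\ T.+1 - N <= l).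
      by apply: IH; [exact: ltnW|exists k', l'].
    exists k, l; split => // k' l' g'; rewrite leqNgt; apply/negP => ll.
    by case: no; exists k', l'; split => //; lia.
  apply: (step T.+1) => //; exists k0.
  have [b [h [st H]]] := probe_run Hk0.
  by exists (size h); split; [split => //; exists b, h, st | lia].
exists [seq a <- a1 :: map fst h1 | a \in adm S n].
  rewrite size_filter (leq_trans (count_size _ _)) //= size_map ltnS.
  exact: leq_trans (hsize _ _ _ _ _ Ho1) Ht1.
split=> [a|k Hk]; first by rewrite mem_filter => /andP [].
suff [a [aW ak ah]] : exists a, [/\ a \in adm S n, restrict J a \in rel_of k &
    a \in a1 :: map fst h1].
  by apply/hasP; exists a; rewrite // mem_filter aW.
have [b [h [st H]]] := probe_run Hk.
have lh : size h <= l by apply: (Hmax k); split => //; exists b, h, st.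
case: H => - [t Ht Ho] [a [aW Ha ak]].
(* The longest run and the run for [k] are compared on the device that refuses whatever either of
   them refuses. *)
pose both a := miss k1 a && miss k a.
have sub1 : subdevice (probe both) (probe (miss k1)) by apply: probe_sub => c /andP [].
have sub2 : subdevice (probe both) (probe (miss k)) by apply: probe_sub => c /andP [].
have [M1|[e1 [e2 [s1 [u1 [M1 _ Hq [l2 Hs]]]]]]] := out_sub sub1 suffix_of_refl
    suffix_of_trans (@suffix_probe _) Ho1; last first.
  (* The longest run passes a query [c] that is legal for [k1] but not for both, so [c] hits the
     relation [k] and occurs in [h1]. *)
  have := out_blocked M1; move: Hq; rewrite /=; case: pickP => // c /andP [cW Hc].
  rewrite /both; case: ifPn => // _ [Ee2] /=; rewrite /miss; case: ifPn => //.
  rewrite negbK => ck _; exists c; split => //.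
  by rewrite inE Hs -Ee2 map_cat mem_cat /= mem_head !orbT.
have [M2|[e1 [e2 [s1 [u1 [M2 _ Hq [l2 Hs]]]]]]] := out_sub sub2 suffix_of_refl
    suffix_of_trans (@suffix_probe _) Ho.
  have [_ _ Est _] := out_det M1 M2; exists a1; split => //; last exact: mem_head.
  by move: ak; rewrite -Est in Ha; rewrite (spells_inj Ha1 Ha).
(* The run for [k] would continue after the whole history [h1] with a further query, against the
   maximality of [h1]. *)
have [_ Eh _ _] := out_det M1 M2.
move: Hq; rewrite /=; case: pickP => // c _; case: ifP => // _ [Ee2].
by move: lh; rewrite Hs -Ee2 -Eh size_cat /= -Hl; lia.
Qed.

Lemma nrel_bound (D : cmd) (t : nat) :
  (forall (r : rname (union_type S) n) (u : qtuple S n), u \in Wq S n ->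
    exists st k, [/\ exec (member_device r u) D tt store0 tt st k, k <= t &
      (var st 0 != 0) = (u \in rden r)]) ->
  nrel S n <= 1 + T.+1 * t.
Proof.
move=> HD; have [s sT [sW Hs]] := hitting_set.
pose G := [set k : 'I_(nrel S n) | rel_of k != set0].
(* The relations are pairwise distinct, so at most one of them is empty; this is the summand 1. *)
have G1 : #|~: G| <= 1.
  apply/card_le1P => k; rewrite !inE negbK => /eqP Hk k'; rewrite !inE negbK.
  apply/eqP/eqP => [Hk'|->//]; apply: (rel_inj n_gt0); by rewrite Hk Hk'.
have G2 : #|G| <= size s * t.
  apply: (@card_cover_le _ _ _ (fun a => [set k | restrict J a \in rel_of k])).
    move=> a /sW aW; apply: (card_containing HD).
    exact: restrict_Wq (first_vars_uniq _ _) aW.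
  move=> k; rewrite inE => /Hs /hasP [a As ak]; apply/hasP; exists a => //.
  by rewrite inE.
rewrite -[X in X <= _]card_ord -(cardsC G) addnC leq_add //.
by rewrite (leq_trans G2) // leq_mul2r sT orbT.
Qed.

End LowerBound.

(** * The program for part (b) *)

Notation vX := 18 (only parsing).
Notation vEmpty := 21 (only parsing).
Notation vReply := 36 (only parsing).

Definition check_nonempty : cmd :=
  For vG vI vM (Seq (Const vT 0) (Seq
    (For vG vK vS (Seq (Read vX 1 vI vK) (If vX (Const vT 1) Skip)))
    (If vT Skip (Const vEmpty 1)))).

Definition union_name (x y : nat) : cmd := Read x 1 vJ y.
Definition queried_value (x y : nat) : cmd := Seq (Read 11 2 vJ y) (geta 1 14 x 0 11).

Definition test_union (D : cmd) : cmd :=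
  Seq (reset 2 (vbound D)) (compile 2 (read_member union_name queried_value) Skip D).

(* Variable [vReply] holds 0 if there was no reply yet, and otherwise the
   successor of the index of the violated constraint. *)
Definition answer_query (D : cmd) : cmd :=
  Seq (Const vX 0) (Seq
    (For vG vJ vM (Seq (test_union D)
      (If (xv 2 0) Skip (Seq (Const vT 1) (Add vX vJ vT)))))
    (If vX (Seq (Const vT 0) (Add vReply vX vT)) (Const (tv 1 0) 1))).

(** The reply yes never reaches the simulated algorithm, so cell 0 of field 1 is constantly 0. The
    revealed scope is read from the input instance. *)
Definition read_reply (x f y z : nat) : cmd :=
  match f with
  | 0 => Read x 0 y z
  | 1 => Seq (Const 10 1) (Seq (Sub 13 y 10) (Seq (Sub 10 10 y) (Seq (Add 10 10 13)
           (If 10 (Const x 0) (Seq (Const 10 1) (Sub x vReply 10))))))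
  | 2 => If vReply (Seq (Const 10 1) (Seq (Sub 10 vReply 10) (Read x 2 10 y))) (Const x 0)
  | _ => Const x 0
  end.

(** Array 0 serves for queries as well as for answers, so an aborted run and a run that ends with an
    assignment are treated alike: the simulated array 0 is copied out. *)
Definition solve_union (B D : cmd) : cmd :=
  Seq read_params (Seq check_nonempty (If vEmpty (Const vAns 0)
    (Seq (compile 1 read_reply (answer_query D) B)
    (Seq (If (tv 1 0) (Const vAns 1) (Seq (Const vT 0) (Add vAns (xv 1 0) vT)))
         (If vAns (copy_out 1) Skip))))).

(** * Replies common to all choices of relations *)

Section PartB.
Variables (S : csp) (n m : nat) (C : instance (union_type S) n m).

Definition violated (a : assignment S n) (j : nat) : bool :=
  if insub j is Some i then ~~ sat_constr (tnth C i) a else false.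

(** The last violated constraint is taken because the program tests all of them in order without
    stopping early. The value is an index plus one, 0 meaning that there is none. *)
Fixpoint last_violated (a : assignment S n) (k : nat) : nat :=
  if k is k'.+1 then if violated a k' then k else last_violated a k' else 0.

Definition reply_to (a : assignment S n) : option 'I_m :=
  if last_violated a m is j.+1 then insub j else None.

Lemma last_violated_le a k : last_violated a k <= k.
Proof. by elim: k => //= k IH; case: ifP => // _; apply: leqW. Qed.

Lemma last_violatedP a k : if last_violated a k is j.+1 then violated a j
  else forall i, i < k -> ~~ violated a i.
Proof.
elim: k => //= k; case: ifPn => // nv.
case: (last_violated a k) => // H i; rewrite ltnS leq_eqVlt => /predU1P [->//|].
exact: H.
Qed.

Lemma reply_toP a : if reply_to a is Some j
  then ~~ sat_constr (tnth C j) a /\ last_violated a m = j.+1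
  else sat C a /\ last_violated a m = 0.
Proof.
rewrite /reply_to; have := last_violatedP a m; have := last_violated_le a m.
case: (last_violated a m) => [_ H|j jm].
  split=> //; apply/forallP => j; have := H j (ltn_ord j).
  by rewrite /violated valK negbK.
rewrite /violated; case: insubP => [i _ <-|]; first by [].
by rewrite jm.
Qed.

(** It is defined by the union instance alone; the only admissible queries that it refuses are the
    solutions of [C]. *)
Definition conclusive : device (history S n m) :=
  Device (fun h f y _ =>
      match f with
      | 0 => param_input S n m y
      | 1 => match last_reply h with
             | None => 0
             | Some None => nth 0 [:: 1] y
             | Some (Some j) => nth 0 [:: 0; val j] y
             end
      | 2 => if last_reply h is Some (Some j)
             then nth 0 (map val (cscope (tnth C j))) y else 0
      | _ => 0
      end)
    (fun h f => if [pick a in adm S n | spells f a] is Some a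
      then if reply_to a is Some j then Some ((a, Some j) :: h) else None else None).

Definition base_instance (k : 'I_m -> 'I_(nrel S n)) : instance (base_type S) n m :=
  [tuple @Constr _ (base_type S) n (k j) _ (cscope_uniq (tnth C j)) | j < m].

(** A valid oracle must also answer queries that satisfy all the unions but not all the chosen
    relations; there any violated constraint will do. *)
Definition base_oracle k : oracle S n m := fun h a =>
  if reply_to a is Some j then Some j
  else [pick j | ~~ sat_constr (tnth (base_instance k) j) a].

Lemma base_violated k j a : k j \in crel (tnth C j) ->
  ~~ sat_constr (tnth C j) a -> ~~ sat_constr (tnth (base_instance k) j) a.
Proof.
move=> kj; apply: contra; rewrite /sat_constr tnth_mktuple /= => H.
by apply/bigcupP; exists (k j).
Qed.

Lemma base_oracle_valid k : (forall j, k j \in crel (tnth C j)) ->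
  valid_oracle (base_instance k) (base_oracle k).
Proof.
move=> Hk h a _; rewrite /base_oracle; have := reply_toP a.
case: (reply_to a) => [j [Hj _]|_]; first exact: base_violated.
case: pickP => // H; apply/forallP => j; by have := H j; move/negbFE.
Qed.

Lemma conclusive_sub k :
  subdevice conclusive (hidden_device (base_instance k) (base_oracle k)).
Proof.
split=> [h [|[|[|f]]] y z|h f h'] //=.
  by case: last_reply => // - [j|] //; rewrite tnth_mktuple.
by case: pickP => // a _; rewrite /base_oracle; case: (reply_to a).
Qed.

Lemma sat_base_sub k a : (forall j, k j \in crel (tnth C j)) ->
  sat (base_instance k) a -> sat C a.
Proof.
move=> Hk /forallP H; apply/forallP => j; apply/negPn/negP => /(base_violated (Hk j)).
by rewrite H.
Qed.

Lemma sat_base a : sat C a -> exists2 k : 'I_m -> 'I_(nrel S n),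
  forall j, k j \in crel (tnth C j) & sat (base_instance k) a.
Proof.
move=> /forallP H.
have Hk j : exists k, (k \in crel (tnth C j)) && (restrict (cscope (tnth C j)) a \in rel_of k).
  by have /bigcupP [k k1 k2] := H j; exists k; rewrite k1.
exists (fun j => xchoose (Hk j)) => [j|]; first by case/andP: (xchooseP (Hk j)).
by apply/forallP => j; rewrite /sat_constr tnth_mktuple; case/andP: (xchooseP (Hk j)).
Qed.

Section Run.
Variables (B : cmd) (T : nat).
Hypothesis HB : forall (C : instance (base_type S) n m) (O : oracle S n m),
  valid_oracle C O -> exists h st k,
    [/\ exec (hidden_device C O) B [::] store0 h st k,
        k + output_steps S n st <= T & correct_answer C st].

(** On a satisfiable choice of relations the hidden algorithm has to write out an assignment. This
    pays for copying out the query of an aborted run, in which the algorithm itself has output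
    nothing. *)
Lemma sat_len a : a \in adm S n -> sat C a -> len S n <= T.
Proof.
move=> aW aC; have [k Hk ak] := sat_base aC.
have [h [st [t [_ Ht]]]] := HB (base_oracle_valid Hk).
rewrite /correct_answer; move: Ht; rewrite /output_steps; case: ifP => _; last by lia.
by move=> _ /(_ a aW); rewrite ak.
Qed.

(* A conclusive run is a run against every base instance at once, hence a
   negative answer rules all of them out. *)
Lemma conclusive_run : (forall j, crel (tnth C j) != set0) ->
  exists b h st t, [/\ out conclusive B [::] store0 b h st t, t <= T &
    if b then correct_answer C st /\ output_steps S n st <= T
    else exists a, [/\ a \in adm S n, spells (arr st 0) a, sat C a & len S n <= T]].
Proof.
move=> HC.
have Hk0 j : exists k, k \in crel (tnth C j) by apply/set0Pn.
pose k0 j := xchoose (Hk0 j).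
have Hk : forall j, k0 j \in crel (tnth C j) by move=> j; apply: xchooseP.
have [h [st [t [Hex Ht Hans]]]] := HB (base_oracle_valid Hk).
have tT : t <= T by lia.
have [Ho|[h1 [h2 [st1 [t1 [Ho Ht1 Hq _]]]]]] :=
  out_sub (le := fun _ _ => True) (conclusive_sub k0) (fun _ => I) (fun _ _ _ _ _ => I)
    (fun _ _ _ _ => I) (exec_out Hex).
  exists true, h, st, t; split => //; split; last by lia.
  move: Hans; rewrite /correct_answer; case: ifP => st0 Hans; last first.
    have [a [aW aC Ha]] := Hans; exists a; split => //.
    exact: sat_base_sub aC.
  move=> a aW; apply/negP => aC; have [k Hk' ak] := sat_base aC.
  have [h' [st' [t' [Hex' _]]]] := HB (base_oracle_valid Hk').
  have [_ <- _] := exec_det (exec_sub (conclusive_sub k) (out_exec Ho)) Hex'.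
  by rewrite /correct_answer st0 => /(_ a aW); rewrite ak.
exists false, h1, st1, t1; split => //; first exact: leq_trans tT.
have := out_blocked Ho; move: Hq; rewrite /=; case: pickP => // a /andP [aW Ha] _.
have := reply_toP a; case: (reply_to a) => // - [aC _] _.
by exists a; split => //; apply: sat_len aC.
Qed.

End Run.

Local Notation io := (csp_device C).

Definition basic (st : store) : Prop :=
  [/\ var st vM = m, var st vS = nrel S n, var st vQ = arity S n & var st vL = len S n].

Lemma basic_set st x v : x \notin [:: 3; 6; 9; 12] -> basic st -> basic (set_var st x v).
Proof.
by move=> Hx [A1 A2 A3 A4]; split; rewrite var_set; case: eqP => // E; rewrite -E in Hx.
Qed.

Lemma basic_same r st st' : 0 < r < 3 -> same r st st' -> basic st -> basic st'.
Proof. by move=> Hr [Hv _] [A1 A2 A3 A4]; split; rewrite Hv //; lia. Qed.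

Definition tracks (h : history S n m) (e : unit) (st : store) : Prop :=
  [/\ basic st, ready 2 st, last_reply h <> Some None &
    var st vReply = if last_reply h is Some (Some j) then j.+1 else 0].

Section Simulate.
Variables (D : cmd) (t : nat).
Hypothesis n_gt0 : 0 < n.
Hypothesis HD : forall (r : rname (union_type S) n) (u : qtuple S n), u \in Wq S n ->
  exists st k, [/\ exec (member_device r u) D tt store0 tt st k, k <= t &
    (var st 0 != 0) = (u \in rden r)].

Lemma test_union_spec N sst a (j : 'I_m) st :
  a \in adm S n -> spells (arr sst 0) a -> sim 1 N sst st -> var st vQ = arity S n ->
  var st vJ = j -> ready 2 st ->
  tri io (test_union D) tt st ((vbound D).+3 + 20 * t) (fun e' st' =>
    [/\ same 2 st st', ready 2 st' &
      (var st' (xv 2 0) != 0) = sat_constr (tnth C j) a]).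
Proof.
move=> aW Ha Hsim HQ HJ Hr; pose u := restrict (cscope (tnth C j)) a.
have uW : u \in Wq S n by apply: restrict_Wq (cscope_uniq _) aW.
have [s2 [t' [Hex Ht Hans]]] := HD (crel (tnth C j)) uW.
have H := @run_program _ _ (member_device (crel (tnth C j)) u) io 2
   (read_member union_name queried_value) 20 D tt s2 t' tt tt st isT isT
   (fun _ _ => erefl) _ Hr Hex.
apply: tri_weak (H _) _ _.
- move=> N' x f y z s1 st1 hx hy hz Hs Hsame; have [Hv Harr] := Hsame.
  apply: read_member_spec hx hy hz Hs => //.
  + by rewrite Hv.
  + move=> x' y' hy'; rewrite /loads /=; eexists; last first.
      rewrite Hv // HJ (nth_map_tuple (fun c : constr (union_type S) n => rcode (crel c))).
      reflexivity.
    by tmps 2.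
  + move=> x' y' w i hy' Hy'; rewrite /loads /queried_value /geta; cbn [ev].
    set s3 := set_var (set_var st1 11 w) 11 _.
    have E3 : s3 = set_var (set_var st1 11 w) 11 (tnth (cscope (tnth C j)) i).
      rewrite /s3 !var_set xv_eq // Hy' /= Hv // HJ.
      by rewrite (nth_map_tuple (fun c : constr (union_type S) n => map val (cscope c)))
        (nth_map_tuple val).
    (* The query stands in the simulated array 0 of class 1, which the membership test running in
       class 2 does not touch. *)
    have G : sget 1 st1 0 (tnth (cscope (tnth C j)) i) = tnth u i.
      rewrite (sget_same _ _ _ _ _ Hsame) // -(sim_get _ _ Hsim).
      by move/spellsP: Ha => ->; rewrite tnth_mktuple.
    rewrite E3 /= /upd /=; move: G; rewrite /sget /=; case: eqP => _ /= G.
      by rewrite -G; eexists; last reflexivity; tmps 2.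
    by rewrite -G; eexists; last reflexivity; tmps 2.
- by rewrite leq_add2l leq_mul2l Ht orbT.
- move=> [] st' [_ Hsame [Hv _ Hrd]]; split => //.
  by rewrite Hv ?vbound_gt0 // Hans.
Qed.

Definition query_bound := 1 + ((m.+1 * ((vbound D).+3 + 20 * t + 3 + 4) + 3) + 3).

Lemma answer_query_spec N sst a h e st :
  a \in adm S n -> spells (arr sst 0) a -> sim 1 N sst st -> tracks h e st ->
  tri io (answer_query D) tt st query_bound (fun e' st' =>
    if reply_to a is Some j then sim 1 N sst st' /\ tracks ((a, Some j) :: h) tt st'
    else [/\ var st' (tv 1 0) != 0, basic st' & forall i, arr sst 0 i = sget 1 st' 0 i]).
Proof.
move=> aW Ha Hsim [Hb Hr Hl HR]; rewrite /answer_query /query_bound.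
apply: tri_seq; apply: tri_simple => //; set st1 := ev _ _ _ _.
pose I k (e : unit) s := [/\ sim 1 N sst s, basic s, ready 2 s,
  var s vX = last_violated a k & var s vReply = var st vReply].
have Iset x k e0 s v : x \in [:: vG; vJ] -> I k e0 s -> I k e0 (set_var s x v).
  move=> Hx [A1 A2 A3 A4 A5].
  have G : chg [:: vG; vJ] [::] s (set_var s x v) by apply: chg_set.
  have n3 : x %% 3 != 1 by move: Hx; rewrite !inE => /orP [] /eqP ->.
  split.
  - by apply: sim_temp => //; rewrite n3.
  - by apply: basic_set => //; move: Hx; rewrite !inE => /orP [] /eqP ->.
  - exact: ready_chg G A3.
  - by rewrite (proj1 G).
  - by rewrite (proj1 G).
have HM : var st1 vM = m by case: Hb.
apply: tri_seq.
apply: tri_weak (tri_for (I := I) (N := m) (b := (vbound D).+3 + 20 * t + 3)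
  _ _ _ _ _ _ HM _) (leqnn _) _ => //.
- by move=> k e1 s v; apply: Iset.
- by move=> k e1 s v; apply: Iset.
- move=> k e1 s km Hk Hn [A1 A2 A3 A4 A5].
  have HQ : var s vQ = arity S n by case: A2.
  case: e1; apply: (tri_then (test_union_spec (j := Ordinal km) aW Ha A1 HQ Hk A3)).
    exact: leq_addr.
  move=> e2 s2 [Hsame Hr2 Hans]; rewrite addKn.
  have B1 : sim 1 N sst s2 by apply: sim_same Hsame A1.
  have B2 : basic s2 by apply: basic_same Hsame A2.
  have [Hv _] := Hsame.
  have lvE : last_violated a k.+1 =
      if ~~ sat_constr (tnth C (Ordinal km)) a then k.+1 else last_violated a k.
    by rewrite /= /violated insubT.
  apply: tri_if_le => // Hx; apply: tri_simple => //.
    split; rewrite /ev ?Hv //; split; rewrite ?Hv //.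
    by rewrite A4 lvE -Hans Hx.
  have G : chg [:: vT; vX] [::] s2 (ev io e2 (Seq (Const vT 1) (Add vX vJ vT)) s2).
    by rewrite /ev; do !apply: chg_set => //.
  split; [by rewrite (proj1 G) // Hv|by rewrite (proj1 G) // Hv|].
  split; [|by do !apply: basic_set => //|exact: ready_chg G Hr2| |by rewrite (proj1 G) // Hv].
    by do !apply: sim_temp => //.
  by rewrite lvE -Hans Hx /= /upd /= Hv // Hk addn1.
- have G : chg [:: vX] [::] st st1 by apply: chg_set.
  have z : zero_class [:: vX] by [].
  split; [exact: sim_temp|exact: basic_set|exact: (ready_chg _ z _ G Hr)|by []|by []].
move=> [] s1 [_ [A1 A2 A3 A4 A5]]; have := reply_toP a.
case: (reply_to a) => [j [_ E]|[_ E]]; apply: tri_if => Hx;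
  apply: tri_simple => //; try by rewrite A4 E in Hx.
- have G : chg [:: vT; vReply] [::] s1
      (ev io tt (Seq (Const vT 0) (Add vReply vX vT)) s1).
    by rewrite /ev; do !apply: chg_set => //.
  split; first by do !apply: sim_temp => //.
  split; [by do !apply: basic_set => //|exact: ready_chg G A3|by []|].
  by rewrite /= /upd /= A4 E addn0.
- by have [B1 B2 B3] := A1.
Qed.

End Simulate.

Lemma read_reply_spec N sst h e st x f y z :
  x < N -> y < N -> z < N -> sim 1 N sst st -> tracks h e st ->
  exists st' k,
    [/\ exec io (read_reply (xv 1 x) f (xv 1 y) (xv 1 z)) e st e st' k, k < 20,
        same 1 st st' &
        sim 1 N (set_var sst x (io_read conclusive h f (var sst y) (var sst z))) st'].
Proof.
move=> hx hy hz Hs [[A1 A2 A3 A4] Hr Hl HR]; have [Hv _ _] := Hs.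
have ey : (xv 1 y == 10) = false by apply: xv_eq.
have ey3 : (xv 1 y == 13) = false by apply: xv_eq.
case: f => [|[|[|f]]].
- by apply: loads_run => //; exists st => //=; rewrite Hv.
- have E (k : nat) : io_read conclusive h 1 k (var sst z) =
      if k == 1 then (if last_reply h is Some (Some j) then j.+1 else 0) - 1 else 0.
    rewrite /=; case: (last_reply h) Hl => [[j|]|] //; case: k => [|[|[|k]]] //=;
      by rewrite ?subn1.
  rewrite E; apply: loads_run => //; rewrite /loads /= /upd /= ey ?ey3 Hv // HR.
  have [->|ne] /= := eqVneq (var sst y) 1.
    by eexists; last reflexivity; tmps 1.
  have -> : (1 - var sst y + (var sst y - 1) == 0) = false by lia.
  by eexists; last reflexivity; tmps 1.
- apply: loads_run => //; rewrite /loads /= /upd /= HR.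
  case: (last_reply h) => [[j|]|] /=; try by eexists; last reflexivity; tmps 1.
  rewrite ey Hv // subn1 /= (nth_map_tuple (fun c : constr (union_type S) n => map val (cscope c))).
  by eexists; last reflexivity; tmps 1.
- by apply: loads_run => //; exists st.
Qed.

Definition listed (i k : nat) : bool := io_read io tt 1 i k != 0.

Lemma listedE (j : 'I_m) (k : 'I_(nrel S n)) : listed j k = (k \in crel (tnth C j)).
Proof.
rewrite /listed /= (nth_map_tuple (fun c : constr (union_type S) n => rcode (crel c))) /=.
by rewrite valK; case: (k \in _).
Qed.

Lemma has_iotaS (p : pred nat) k : has p (iota 0 k.+1) = has p (iota 0 k) || p k.
Proof. by rewrite -addn1 iotaD has_cat /= orbF. Qed.

Lemma all_iotaS (p : pred nat) k : all p (iota 0 k.+1) = all p (iota 0 k) && p k.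
Proof. by rewrite -addn1 iotaD all_cat /= andbT. Qed.

Definition check_bound := m.+1 * ((nrel S n).+1 * 7 + 7 + 4) + 3.

Lemma check_nonempty_spec st : basic st -> var st vEmpty = 0 ->
  tri io check_nonempty tt st check_bound (fun e' st' =>
    [/\ basic st', chg [:: vG; vI; vT; vK; vX; vEmpty] [::] st st' &
      (var st' vEmpty == 0) = [forall j, crel (tnth C j) != set0]]).
Proof.
move=> Hb H0; set xs := [:: _; _; _; _; _; _].
have [HM HS _ _] := Hb.
pose row_ok i := has (listed i) (iota 0 (nrel S n)).
pose I k (e : unit) s := chg xs [::] st s /\ (var s vEmpty == 0) = all row_ok (iota 0 k).
apply: tri_weak (tri_for (I := I) (b := (nrel S n).+1 * 7 + 7) _ _ _ _ _ _ HM _) _ _ => //.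
- by move=> k e s v [A B]; split => //; apply: chg_set.
- by move=> k e s v [A B]; split => //; apply: chg_set.
- move=> i e s im Hi Hn [A B].
  have -> : (nrel S n).+1 * 7 + 7 = 1 + ((nrel S n).+1 * (3 + 4) + 3 + 3) by lia.
  apply: tri_seq; apply: tri_simple => //; set s1 := ev _ _ _ _.
  pose I2 k (e : unit) s' := [/\ chg xs [::] st s', var s' vI = i,
    var s' vEmpty = var s vEmpty & (var s' vT != 0) = has (listed i) (iota 0 k)].
  have HS1 : var s1 vS = nrel S n by rewrite /s1 /= /upd /= (proj1 A).
  apply: tri_seq.
  apply: tri_weak (tri_for (I := I2) (b := 3) _ _ _ _ _ _ HS1 _) (leqnn _) _ => //.
  + by move=> k e' s' v [A1 A2 A3 A4]; split => //; apply: chg_set.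
  + by move=> k e' s' v [A1 A2 A3 A4]; split => //; apply: chg_set.
  + move=> k [] s' ks Hk Hn' [A1 A2 A3 A4]; apply: tri_simple => //.
    rewrite /ev !var_set /= A2 Hk.
    have <- : listed i k = (nth (fun=> 0) [seq rcode (crel c) | c <- C] i k != 0) by [].
    case E: (listed i k); split; rewrite ?var_set //; split; rewrite ?var_set //;
      try (by do !apply: chg_set => //); by rewrite has_iotaS E ?orbT // orbF.
  + by split => //; apply: chg_set.
  move=> [] s2 [HS2 [A1 A2 A3 A4]].
  have HM2 : var s2 vM = m by rewrite (proj1 A1).
  apply: tri_if => Hx; apply: tri_simple => //.
    split => //; split => //; rewrite /ev A3 B all_iotaS /row_ok -A4 Hx.
    by rewrite andbT.
  split => //; split; first exact: chg_set.
  by rewrite all_iotaS /row_ok -A4 Hx /= andbF.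
- by split; rewrite ?H0.
- move=> e s [HM' [A B]]; split => //.
    by case: Hb => H1 H2 H3 H4; split; rewrite (proj1 A).
  rewrite B; apply/allP/forallP => [H j|H i].
    have jm : val j \in iota 0 m by rewrite mem_iota ltn_ord.
    have /hasP [k] := H _ jm; rewrite mem_iota /= add0n => ks.
    by rewrite -[k]/(val (Ordinal ks)) listedE => Hk; apply/set0Pn; exists (Ordinal ks).
  rewrite mem_iota add0n /= => im; have /set0Pn [k Hk] := H (Ordinal im).
  by apply/hasP; exists (val k); rewrite ?mem_iota ?ltn_ord // -[i]/(val (Ordinal im)) listedE.
Qed.

Section Main.
Variables (B D : cmd) (T t : nat).
Hypothesis n_gt0 : 0 < n.
Hypothesis HD : forall (r : rname (union_type S) n) (u : qtuple S n), u \in Wq S n ->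
  exists st k, [/\ exec (member_device r u) D tt store0 tt st k, k <= t &
    (var st 0 != 0) = (u \in rden r)].
Hypothesis HB : forall (C : instance (base_type S) n m) (O : oracle S n m),
  valid_oracle C O -> exists h st k,
    [/\ exec (hidden_device C O) B [::] store0 h st k,
        k + output_steps S n st <= T & correct_answer C st].

Definition step_bound := 20 + query_bound D t.

(** The factor [T.+1] instead of [T] covers the aborted query, and the term with [size_cmd B] the
    unwinding after it. *)
Definition solve_bound :=
  9 + (check_bound + ((step_bound * T.+1 + 4 * size_cmd B) + (3 + (T.+1 * 9 + 3).+1)).+1).

Lemma solve_union_spec : tri io (solve_union B D) tt store0 solve_bound (fun e' st' =>
  correct_answer C st' /\ output_steps S n st' <= T).
Proof.
rewrite /solve_union /solve_bound; apply: tri_seq; apply: tri_simple => //.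
set st1 := ev _ _ _ _.
have b1 : basic st1 by [].
have G1 : chg [:: vT; vM; vL; vQ; vS; vW] [::] store0 st1.
  by rewrite /st1 /ev; do !apply: chg_set => //.
apply: tri_seq; apply: tri_weak (check_nonempty_spec b1 erefl) (leqnn _) _.
move=> [] st2 [b2 G2 Hemp].
have Z x : x \notin [:: vT; vM; vL; vQ; vS; vW; vG; vI; vK; vX; vEmpty] -> var st2 x = 0.
  move=> Hx; rewrite (proj1 G2) ?(proj1 G1) //.
    by apply: contra Hx; rewrite !inE => H; lia.
  by apply: contra Hx; rewrite !inE => H; lia.
have Za a i : arr st2 a i = 0 by rewrite (proj2 G2) // (proj2 G1).
apply: tri_if => Hx.
  apply: tri_weak (_ : tri io (Const vAns 0) tt st2 1 _) _ (fun _ _ H => H) => //.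
  apply: tri_simple => //; split => //; rewrite /correct_answer /=.
  move: Hx; rewrite Hemp negb_forall => /existsP [j]; rewrite negbK => /eqP Hj a _.
  apply/negP => /forallP /(_ j); rewrite /sat_constr Hj /=.
  by rewrite big_set0 inE.
have HC : forall j, crel (tnth C j) != set0 by apply/forallP; rewrite -Hemp Hx.
have [b [h [sst [t0 [Ho Ht Hans]]]]] := conclusive_run HB HC.
have ready0 r : 0 < r < 3 -> ready r st2.
  move=> Hr; split=> [|a i]; last by rewrite Za.
  by apply: Z; rewrite !inE /tv; lia.
have sim0 : sim 1 (vbound B) store0 st2.
  split; last exact: ready0.
    by move=> x _; rewrite Z // !inE /xv; lia.
  by move=> a i; rewrite /sget !Za; case: ifP.
have tr0 : tracks [::] tt st2.
  by split => //; [exact: ready0|exact: Z].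
have C8 : 8 <= step_bound by [].
pose Stop (h : history S n m) sst (e : unit) st :=
  basic st /\ forall i, arr sst 0 i = sget 1 st 0 i.
pose Blk (h : history S n m) (sst : store) := exists a,
  [/\ a \in adm S n, spells (arr sst 0) a, sat C a & len S n <= T].
have Inv_same h' e s s' : same 1 s s' -> tracks h' e s -> tracks h' e s'.
  move=> Hs [A1 A2 A3 A4]; split => //; first exact: basic_same Hs A1.
    exact: ready_same Hs A2.
  by rewrite (proj1 Hs).
have Stop_set h' ss e s x v : Stop h' ss e s -> Stop h' ss e (set_var s (xv 1 x) v).
  move=> [A1 A2]; split.
    by apply: basic_set => //; rewrite !inE /xv; lia.
  move=> i; rewrite A2 /sget var_set.
  by have -> : (tv 1 1 == xv 1 x) = false by rewrite /tv /xv; lia.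
have Hrd x f y z h' ss e s : x < vbound B -> y < vbound B -> z < vbound B ->
    sim 1 (vbound B) ss s -> tracks h' e s ->
    exists st' k, [/\ exec io (read_reply (xv 1 x) f (xv 1 y) (xv 1 z)) e s e st' k,
      k < step_bound, same 1 s st' &
      sim 1 (vbound B) (set_var ss x (io_read conclusive h' f (var ss y) (var ss z))) st'].
  move=> hx hy hz Hs Htr; have [st' [k [A1 A2 A3 A4]]] := read_reply_spec f hx hy hz Hs Htr.
  by exists st', k; split => //; apply: leq_trans A2 _; apply: leq_addr.
have HqT h' h2 ss e s : sim 1 (vbound B) ss s -> tracks h' e s ->
    io_query conclusive h' (arr ss 0) = Some h2 ->
    exists e2' st' k, [/\ exec io (answer_query D) e s e2' st' k, k < step_bound,
      sim 1 (vbound B) ss st' & tracks h2 e2' st'].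
  move=> Hs Htr; rewrite /=; case: pickP => // a /andP [aW Ha].
  have [[] [st' [k [A1 A2 A3]]]] := answer_query_spec n_gt0 HD aW Ha Hs Htr.
  case: (reply_to a) A3 => // j [A3 A4] [<-]; case: e Htr A1 => _ A1.
  by exists tt, st', k; split => //; rewrite /step_bound; lia.
have HqF h' ss e s : sim 1 (vbound B) ss s -> tracks h' e s -> Blk h' ss ->
    exists e2' st' k, [/\ exec io (answer_query D) e s e2' st' k, k < step_bound,
      var st' (tv 1 0) != 0 & Stop h' ss e2' st'].
  move=> Hs Htr [a [aW Ha aC _]].
  have [[] [st' [k [A1 A2 A3]]]] := answer_query_spec n_gt0 HD aW Ha Hs Htr.
  have := reply_toP a; case: (reply_to a) A3 => [j _ [] |[A3 A4 A5] _].
    by move/forallP: aC => ->.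
  case: e Htr A1 => _ A1.
  by exists tt, st', k; split => //; rewrite /step_bound; lia.
have HBlk : b \/ Blk h sst by case: b Hans {Ho}; [left|right].
have [[] [st3 [k [A1 A2 A3]]]] := simulation (isT : 1 < 3) C8 Inv_same Stop_set Hrd HqT HqF
  Ho HBlk (leqnn _) sim0 tr0.
have kb : k <= step_bound * T.+1 + 4 * size_cmd B.
  have l1 : step_bound * t0.+1 <= step_bound * T.+1 by rewrite leq_mul2l ltnS Ht orbT.
  by case: b A2 {HBlk Ho Hans A3} => A2; rewrite ?mulnS in A2 l1 *; lia.
apply: tri_seq; exists tt, st3, k; split => //.
apply: tri_seq; apply: tri_simple => //; set st4 := ev _ _ _ _.
have G4 : chg [:: vAns; vT] [::] st3 st4.
  by rewrite /st4 /ev; case: ifP => _; do !apply: chg_set => //.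
have b3 : basic st3 by case: b A3 {Ho Hans HBlk A2} => [[_ []]|[_ []]].
have HL : var st4 vL = len S n by case: b3 => _ _ _ <-; rewrite (proj1 G4).
have copied a : spells (arr sst 0) a -> sat C a -> a \in adm S n -> len S n <= T ->
    (forall i, arr sst 0 i = sget 1 st3 0 i) -> var st4 vAns != 0 ->
    tri io (If vAns (copy_out 1) Skip) tt st4 (T.+1 * 9 + 3).+1
     (fun e' st' => correct_answer C st' /\ output_steps S n st' <= T).
  move=> Ha aC aW lT Harr Hnz; apply: tri_if => [_|E]; last by rewrite E in Hnz.
  apply: tri_weak (copy_out_spec io tt (isT : 0 < 1 < 3) HL) _ _.
    by rewrite leq_add2r leq_mul2r ltnS lT.
  move=> e' st5 [_ G5 Hc]; rewrite /correct_answer /output_steps.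
  have -> : (var st5 0 == 0) = false by rewrite (proj1 G5) //; apply: negbTE.
  split => //; exists a; split => //; apply/spellsP => i.
  rewrite Hc // (sget_chg (xs := [:: vAns; vT]) (bs := [::]) _ _ _ _ _ G4) // -Harr.
  by move/spellsP: Ha => ->.
case: b A3 Hans {Ho HBlk A2} => [[Hs _]|[F1 [_ Harr]]] Hans; last first.
  have [a [aW Ha aC lT]] := Hans.
  by apply: (copied a) => //; rewrite /st4 /ev F1.
have [Hv Harr [F0 _]] := Hs; move: Hans; rewrite /correct_answer /output_steps.
have E4 : var st4 vAns = var sst 0.
  by rewrite /st4 /= F0 /= /upd /= addn0 Hv // vbound_gt0.
case: eqP => [E|/eqP ne] [Hans Hout]; last first.
  have [a [aW aC Ha]] := Hans; apply: (copied a) => //; by rewrite E4.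
apply: tri_if => H; first by rewrite E4 E in H.
by apply: tri_simple => //=; rewrite /correct_answer /output_steps E4 E /=.
Qed.

End Main.
End PartB.

Lemma solve_bound_le (S : csp) n m B D T t :
  0 < m -> 0 < T -> 0 < t -> nrel S n <= 1 + T.+1 * t ->
  solve_bound S n m B D T t + T <=
  (4 * vbound D + 4 * size_cmd B + 400) * (T * m * t).
Proof.
move=> m1 T1 t1; rewrite /solve_bound /step_bound /check_bound /query_bound.
move: (nrel S n) (vbound D) (size_cmd B) => s v z Hs.
have [P EP] : exists P, P = T * t by exists (T * t).
have [Q EQ] : exists Q, Q = m * P by exists (m * P).
have -> : T * m * t = Q by rewrite EQ EP mulnCA mulnA.
have TP : T <= P by rewrite EP leq_pmulr.
have tP : t <= P by rewrite EP leq_pmull.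
have PQ : P <= Q by rewrite EQ leq_pmull.
have mQ : m <= Q by rewrite EQ leq_pmulr //; lia.
(* Here the lower bound on the given algorithms is used: 1, [t] and [T * t] are each at most [P], so
   the check of all names costs O(m P). *)
have sP : s <= 3 * P by rewrite mulSn -EP in Hs; lia.
have check : m.+1 * (s.+1 * 7 + 7 + 4) <= 78 * Q.
  have -> : 78 * Q = (2 * m) * (39 * P) by rewrite EQ; lia.
  by apply: leq_mul; lia.
have step : 20 + (1 + (m.+1 * (v.+3 + 20 * t + 3 + 4) + 3 + 3)) <= (2 * v + 87) * (m * t).
  have mt : 0 < m * t by rewrite muln_gt0 m1.
  have : m.+1 * (v.+3 + 20 * t + 3 + 4) <= (2 * m) * ((v + 30) * t).
    apply: leq_mul; first lia.
    have : v + 10 <= (v + 10) * t by rewrite leq_pmulr.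
    by rewrite !mulnDl; lia.
  have -> : 2 * m * ((v + 30) * t) = (2 * v + 60) * (m * t) by lia.
  by rewrite !mulnDl; lia.
have steps : (20 + (1 + (m.+1 * (v.+3 + 20 * t + 3 + 4) + 3 + 3))) * T.+1 <= (4 * v + 174) * Q.
  have -> : (4 * v + 174) * Q = (2 * v + 87) * (m * t) * (2 * T) by rewrite EQ EP; lia.
  by apply: leq_mul => //; lia.
have zQ : 4 * z <= 4 * z * Q by rewrite leq_pmulr //; lia.
rewrite !mulnDl; rewrite mulnDl in steps; lia.
Qed.

Lemma part_b (S : csp) (T : nat -> nat -> nat) (compUR : nat -> nat) :
  hidden_in_time (base_type S) T -> member_in_time (union_type S) compUR ->
  csp_in_O (union_type S) (fun n m => T n m * m * compUR n).
Proof.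
move=> [B HB] [D HD].
exists (4 * vbound D + 4 * size_cmd B + 400), (solve_union B D).
move=> n m n0 m0 C.
have [e [st [k [Hex Hk [Hans Hout]]]]] := solve_union_spec C n0 (HD n n0) (HB n m n0 m0).
case: e Hex => Hex; exists st, k; split => //.
apply: leq_trans (leq_add Hk Hout) _.
have s1 := nrel_gt0 S n0.
apply: solve_bound_le => //.
(* Positivity of [T] needs some run of the hidden algorithm, hence an instance with a valid oracle;
   the constant instance has one. *)
- have [h [s' [k' [Hex' Hk' _]]]] :=
    HB n m n0 m0 _ _ (constant_oracle_valid n0 m0 (Ordinal s1)).
  by have := exec_gt0 Hex'; lia.
- have /card_gt0P [u uW] := Wq_gt0 S n0.
  have [s' [k' [Hex' Hk' _]]] := HD n n0 set0 u uW.
  by have := exec_gt0 Hex'; lia.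
- exact: (nrel_bound n0 m0 (HB n m n0 m0) (HD n n0)).
Qed.

Theorem theorem1 (S : csp) :
  (forall (T : nat -> nat -> nat) (compR : nat -> nat),
     csp_in_time (union_type S) T ->
     member_in_time (base_type S) compR ->
     hidden_in_O (base_type S) (fun n m =>
       (T n m + nrel S n * compR n) * m *
         minn (dim (union_rels S n)) #|Wq S n|)) /\
  (forall (T : nat -> nat -> nat) (compUR : nat -> nat),
     hidden_in_time (base_type S) T ->
     member_in_time (union_type S) compUR ->
     csp_in_O (union_type S) (fun n m => T n m * m * compUR n)).
Proof.
split=> [T compR|T compUR].
- exact: part_a.
- exact: part_b.
Qed.
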